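(* Let $\mathcal{C}$ be the class of all finite tournaments isomorphic to an induced subtournament of $\mathbf{S}(2)$. Every $\mathbf{X}\in\mathcal{C}$ has big Ramsey degree in $\mathcal{C}$ equal to \[T_{\mathcal{C}}(\mathbf{X}) = \frac{2|\mathbf{X}|}{|\mathrm{Aut}(\mathbf{X})|}\cdot \tan^{(2|\mathbf{X}|-1)}(0),\] where $\tan^{(m)}(0)$ denotes the $m$-th derivative of $\tan$ at $0$.
   Context: Let $\mathbb{T}$ be the unit circle in $\mathbb{C}$. The dense local order $\mathbf{S}(2)$ is the tournament whose vertices are the points of $\mathbb{T}$ with rational argument, with an arc from $x$ to $y$ iff $0<\arg(y/x)<\pi$. For tournaments $\mathbf{X},\mathbf{Z}$, $\binom{\mathbf{Z}}{\mathbf{X}}$ denotes the set of induced subtournaments of $\mathbf{Z}$ isomorphic to $\mathbf{X}$. For positive integers $k$ and $L$, $\mathbf{Z}\to(\mathbf{Y})^{\mathbf{X}}_{k,L}$ means: for every map $\chi:\binom{\mathbf{Z}}{\mathbf{X}}\to\{0,\dots,k-1\}$ there is $\widetilde{\mathbf{Y}}\in\binom{\mathbf{Z}}{\mathbf{Y}}$ such that $\chi$ takes at most $L$ values on $\binom{\widetilde{\mathbf{Y}}}{\mathbf{X}}$. The big Ramsey degree $T_{\mathcal{C}}(\mathbf{X})$ is the least $L\in\mathbb{N}\cup\{\infty\}$ such that for every $k\in\mathbb{N}$, $\mathbf{S}(2)\to(\mathbf{S}(2))^{\mathbf{X}}_{k,L}$. $\mathrm{Aut}(\mathbf{X})$ is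 the automorphism group of $\mathbf{X}$. *)

(* Defs.v *)
From mathcomp Require Import all_boot perm.
From Stdlib Require Import Reals QArith Qreals.
From Coquelicot Require Import Coquelicot.

Set Implicit Arguments.
Unset Strict Implicit.
Unset Printing Implicit Defensive.

(* Vertices of S(2): points e^{i theta} of the unit circle with rational
   argument theta (in radians), represented by their argument
   theta in [0, 2*PI). *)
Definition S2vert : Type :=
  { theta : R | (exists q : Q, theta = Q2R q) /\ (0 <= theta < 2 * PI)%R }.

Definition S2angle (x : S2vert) : R := proj1_sig x.

Definition arg_quot (x y : S2vert) : R :=
  let d := (S2angle y - S2angle x)%R in
  if Rle_dec 0 d then d else (d + 2 * PI)%R.

Definition S2arc (x y : S2vert) : Prop := (0 < arg_quot x y < PI)%R.

Definition is_copy (T : finType) (E : rel T) (A : S2vert -> Prop) : Prop :=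
  exists f : T -> S2vert,
    injective f /\
    (forall v, A v <-> exists t, f t = v) /\
    (forall s t, S2arc (f s) (f t) <-> E s t).

Definition is_S2_copy (W : S2vert -> Prop) : Prop :=
  exists g : S2vert -> S2vert,
    injective g /\
    (forall v, W v <-> exists u, g u = v) /\
    (forall x y, S2arc (g x) (g y) <-> S2arc x y).

Definition S2_arrow (T : finType) (E : rel T) (k L : nat) : Prop :=
  forall chi : (S2vert -> Prop) -> 'I_k,
    exists W : S2vert -> Prop,
      is_S2_copy W /\
      exists C : {set 'I_k},
        (#|C| <= L)%nat /\
        forall A : S2vert -> Prop,
          is_copy E A -> (forall v, A v -> W v) -> chi A \in C.

Definition brd_bound (T : finType) (E : rel T) (L : nat) : Prop :=
  forall k : nat, (0 < k)%nat -> S2_arrow E k L.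

Definition in_class (T : finType) (E : rel T) : Prop :=
  exists f : T -> S2vert, injective f /\
    forall s t, S2arc (f s) (f t) <-> E s t.

Definition Aut_tour (T : finType) (E : rel T) : {set {perm T}} :=
  [set p : {perm T} | [forall s, forall t, E (p s) (p t) == E s t]].

(* Main.v *)
(* Cutting the circle at the angles 0 and PI and folding the two halves onto each
   other turns S(2) into a countable dense linear order with two dense colours; two
   points are joined according to their order and to whether their colours agree.
   An n-element X arises from exactly 2n/|Aut X| colour patterns on an n-element
   linear order.

   For one colour pattern one counts Devlin's embedding types. The points are
   represented by an antichain of binary words such that at each level at most one
   of the branches through it splits or ends. Recording these events from the root
   upwards, n points give a code with n - 1 splittings and n ends of branches; with k
   living branches there are k choices for either kind of event. This is the
   recursion (tan^k)' = k (tan^(k-1) + tan^(k+1)) at 0, hence tan^(2n-1)(0) codes.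

   A code and a colour pattern determine the colour of a copy after passing to a
   suitable copy of S(2), by Milliken's theorem, obtained by fusion from the
   Halpern-Lauchli theorem, which in turn follows from the Carlson-Simpson theorem
   on variable words over the alphabet of columns {0,1}^k. Conversely every copy of
   S(2) realizes all codes with all colour patterns: it contains a dense two-coloured
   tree of points, along which branches of the word tree can be made to split or to
   end at will. *)
Require Import Defs.
From mathcomp Require Import all_boot perm.
From mathcomp Require Import zify boolp classical_sets.
From Stdlib Require Import Reals QArith Qreals Lra Lia.
From Coquelicot Require Import Coquelicot.

Set Implicit Arguments.
Unset Strict Implicit.
Unset Printing Implicit Defensive.

Local Open Scope bool_scope.
Local Open Scope nat_scope.

(** * Ultrafilters and the Carlson-Simpson theorem *)

(** Arguments are rational in radians, so the irrationality of pi is what excludes antipodal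
    vertices; without this the folded order would not separate points. Points and words are
    translated in both directions: [delta] sends points to words so that no two branchings or ends
    share a level, and dyadic intervals send coloured words back to points. A strong embedding
    inserted between the two translations leaves codes unchanged, which makes the composite a copy
    of S(2) whose copies of X have a colour depending only on code and pattern. For the lower bound
    each copy of X is coloured by its own code and pattern. This is legitimate because a set of
    points has one increasing enumeration and an antichain has one code. The semigroup arguments are
    run on filters: a filter stands for the closed set of ultrafilters extending it, so minimal
    closed sets become maximal filters. *)

Section Ultrafilters.
Local Open Scope classical_set_scope.
Variable T : Type.
Implicit Types (F G U : set (set T)) (A B X Y : set T).

Definition pfilter F :=
  [/\ F setT, ~ F set0, (forall A B, F A -> F B -> F (A `&` B)) &
      (forall A B, A `<=` B -> F A -> F B)].

Definition ultra U := pfilter U /\ forall A, U A \/ U (~` A).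

Lemma maximal_filter F0 (P : set (set T) -> Prop) :
    pfilter F0 -> P F0 ->
    (forall C : set (set (set T)), C !=set0 -> total_on C subset ->
      (forall F, C F -> [/\ pfilter F, F0 `<=` F & P F]) ->
      P (\bigcup_(F in C) F)) ->
  exists F, [/\ pfilter F, F0 `<=` F, P F &
    forall G, pfilter G -> F `<=` G -> P G -> G = F].
Proof.
move=> pF0 PF0 chainP.
pose Q F := F = set0 \/ [/\ pfilter F, F0 `<=` F & P F].
have [|F [QF Fmax]] := @Zorn_bigcup (set T) Q.
  move=> C CQ totC.
  pose C' := [set F | C F /\ F !=set0].
  have -> : \bigcup_(X in C) X = \bigcup_(X in C') X.
    apply/seteqP; split=> A [F].
      by move=> CF FA; exists F => //; split => //; exists A.
    by move=> [CF _] FA; exists F.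
  have C'P F : C' F -> [/\ pfilter F, F0 `<=` F & P F].
    by move=> [/CQ[->[]|]].
  have [[F C'F]|C'0] := pselect (C' !=set0); last first.
    left; apply/seteqP; split => // A [F C'F _]; apply: C'0; by exists F.
  right; have totC' : total_on C' subset.
    by move=> X Y [CX _] [CY _]; apply: totC.
  have [pF F0F PF] := C'P _ C'F; split.
  - split.
    + by exists F => //; case: pF.
    + by move=> [G /C'P[[]]].
    + move=> A B [G1 C1 A1] [G2 C2 A2].
      have [[_ _ p1 _] _ _] := C'P _ C1; have [[_ _ p2 _] _ _] := C'P _ C2.
      have [s12|s21] := totC' _ _ C1 C2.
        by exists G2 => //; apply: p2 => //; exact: s12.
      by exists G1 => //; apply: p1 => //; exact: s21.
    + move=> A B AB [G CG GA]; exists G => //.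
      have [[_ _ _ pG] _ _] := C'P _ CG; exact: pG GA.
  - by move=> A /F0F FA; exists F.
  - by apply: chainP => //; exists F.
have QF0 : Q F0 by right; split.
have [F_0|[F_n0 []]] : F = set0 \/ F !=set0 /\ Q F.
- have [F0'|/set0P/negP/negPn/eqP] := pselect (F !=set0); [by right|by left].
- exfalso; apply: (Fmax F0) => //; rewrite F_0; split => //.
  by move=> /(_ setT); case: pF0 => + _ _ _ => /[swap] /[apply].
- by move=> F_0; case: F_n0 => A; rewrite F_0.
move=> [pF F0F PF]; exists F; split => // G pG FG PG.
apply: contrapT => GF; apply: (Fmax G).
  by split => // GF'; apply: GF; apply/seteqP; split.
by right; split => // A /F0F /FG.
Qed.

Lemma filter_adjoin F X : pfilter F -> ~ F (~` X) ->
  pfilter [set Y | F (~` X `|` Y)].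
Proof.
move=> [FT F0 FI FS] FnX; split => [||A B|A B AB] /=.
- by rewrite setUT.
- by rewrite setU0.
- by rewrite setUIr; exact: FI.
- by apply: FS => x [|/AB]; [left|right].
Qed.

Lemma ultra_extend F : pfilter F -> exists2 U, ultra U & F `<=` U.
Proof.
move=> pF; have [|U [pU FU _ Umax]] := @maximal_filter F (fun=> True) pF I.
  by [].
exists U => //; split => // A.
have [UnA|UnA] := pselect (U (~` A)); first by right.
left; rewrite -(Umax _ (filter_adjoin pU UnA)) //=.
  by rewrite setUC setUv; case: pU.
by case: pU => _ _ _ US B UB; apply: US UB => x; right.
Qed.

Lemma ultra_max U G : ultra U -> pfilter G -> U `<=` G -> U = G.
Proof.
move=> [pU dU] [_ G0 GI _] UG; apply/seteqP; split => // A GA.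
case: (dU A) => // /UG GnA.
by have := GI _ _ GA GnA; rewrite setICr.
Qed.

Lemma ultraC U A : ultra U -> ~ U A -> U (~` A).
Proof. by move=> [_ /(_ A)[]]. Qed.

Lemma ultraNC U A : ultra U -> U (~` A) -> ~ U A.
Proof. by move=> [[_ U0 UI _] _] UnA UA; have := UI _ _ UA UnA; rewrite setICr. Qed.

Lemma ultraI U A B : ultra U -> U A -> U B -> U (A `&` B).
Proof. by case=> [[_ _ + _] _]; apply. Qed.

Lemma ultraS U A B : ultra U -> A `<=` B -> U A -> U B.
Proof. by case=> [[_ _ _ +] _]; apply. Qed.

Lemma ultra_all (I : eqType) (s : seq I) U (A : I -> set T) : ultra U ->
  (forall i, i \in s -> U (A i)) -> U [set x | forall i, i \in s -> A i x].
Proof.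
move=> uU; elim: s => [|i s IH] H.
  by apply: (@ultraS U setT) => //; case: uU => [[]].
have Us := IH (fun j js => H j (mem_behead (s := i :: s) js)).
apply: (ultraS uU _ (ultraI uU (H i (mem_head _ _)) Us)) => x [Aix H'] j.
by rewrite inE => /orP[/eqP->//|/H'].
Qed.

Lemma ultra_partition (I : finType) U (f : T -> I) : ultra U ->
  exists i, U [set x | f x = i].
Proof.
move=> uU; apply: contrapT => /forallNP H.
have := ultra_all uU (fun i (_ : i \in enum I) => ultraC uU (H i)).
have -> : [set x | forall i, i \in enum I -> (~` [set y | f y = i]) x] = set0.
  by apply/seteqP; split => // x /(_ (f x)); rewrite mem_enum /=; case.
by case: uU => [[]].
Qed.

Lemma filter_ultraP F X : pfilter F ->
  (forall U, ultra U -> F `<=` U -> U X) -> F X.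
Proof.
move=> pF H; apply: contrapT => nFX.
have [|U uU sU] := ultra_extend (@filter_adjoin F (~` X) pF _).
  by rewrite setCK.
have UnX : U (~` X) by apply: sU; rewrite /= setCK setUv; case: pF.
apply: (ultraNC uU UnX); apply: H => // A FA; apply: sU => /=.
by case: pF => _ _ _ FS; apply: FS FA => x; right.
Qed.

End Ultrafilters.

(** * The semigroup of ultrafilters on words and its idempotents *)

Section UltrafilterConvolution.
Local Open Scope classical_set_scope.
Variable B : Type.
Local Notation M := (seq B).
Implicit Types (F G U : set (set M)) (p q r u v : set (set M)) (A X Y : set M).

(** The product of the Stone-Cech compactification of the free monoid; it is continuous in [r] for
    fixed [u]. *)
Definition conv r u : set (set M) :=
  [set X | r [set s | u [set t | X (s ++ t)]]].

Lemma conv_ultra r u : ultra r -> ultra u -> ultra (conv r u).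
Proof.
move=> ur uu; case: (ur) => -[rT r0 rI rS] rd; case: (uu) => -[uT u0 uI uS] ud.
split; [split|] => [||X Y|X Y XY|X]; rewrite /conv /=.
- by apply: rS rT => s _ /=; apply: uS uT.
- by move=> H; apply: r0; apply: rS H => s /=; apply: u0.
- move=> H1 H2; apply: rS (rI _ _ H1 H2) => s /= [K1 K2].
  exact: uS (uI _ _ K1 K2).
- by apply: rS => s /=; apply: uS => t /XY.
- case: (rd [set s | u [set t | X (s ++ t)]]); [by left|right].
  by apply: rS b => s /=; apply: ultraC.
Qed.

Lemma conv_assoc r u v : conv r (conv u v) = conv (conv r u) v.
Proof.
apply/seteqP; split => X; rewrite /conv /=; congr (r _); apply/funext => s /=;
by congr (u _); apply/funext => t /=; congr (v _); apply/funext => w /=;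
  rewrite catA.
Qed.

(** By continuity, [r |-> conv r p] maps the closed set of [G] onto a closed set; the hypothesis
    puts [u] in the closure of the image. The filter [F] is generated by [G] and the preimages [D X]
    of the members of [u]. *)
Lemma conv_divide G p u : pfilter G -> ultra p -> ultra u ->
    (forall X, G [set s | p [set t | X (s ++ t)]] -> u X) ->
  exists r, [/\ ultra r, G `<=` r & conv r p = u].
Proof.
move=> pG up uu H; case: (pG) => GT G0 GI GS.
pose D X := [set s | p [set t | X (s ++ t)]].
pose F := [set Y | exists2 X, u X & G (~` D X `|` Y)].
have pF : pfilter F.
  case: (uu) => -[uT u0 uI uS] ud; split => [||Y1 Y2|Y1 Y2 Y12].
  - by exists setT => //; rewrite setUT.
  - move=> [X uX]; rewrite setU0 => GX; apply: (ultraNC uu _ uX).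
    by apply: H; apply: GS GX => s /=; apply: ultraC.
  - move=> [X1 uX1 G1] [X2 uX2 G2]; exists (X1 `&` X2); first exact: uI.
    apply: GS (GI _ _ G1 G2) => s [K1 K2].
    have [[d1 d2]|nd] := pselect (D X1 s /\ D X2 s).
      by right; split; [case: K1|case: K2].
    left => d12; apply: nd; split; move: d12; apply: ultraS => // t; by case.
  - by move=> [X uX GX]; exists X => //; apply: GS GX => s [|/Y12]; [left|right].
have [r ur Fr] := ultra_extend pF.
have Gr : G `<=` r.
  move=> Y GY; apply: Fr; exists setT; first by case: uu => [[]].
  by apply: GS GY => s; right.
exists r; split => //; apply/esym/ultra_max => //; first by case: (conv_ultra ur up).
by move=> X uX; apply: Fr; exists X => //; rewrite setUC setUv.
Qed.

Definition closed_under_conv F :=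
  forall r u, ultra r -> ultra u -> F `<=` r -> F `<=` u -> F `<=` conv r u.

(** The Ellis-Numakura argument in a minimal closed subsemigroup, given by [H]. Its right translate
    by [p] (filter [H']) and the stabiliser of [p] in it (filter [K]) are closed subsemigroups,
    hence equal to it. *)
Lemma idempotent_ultra F : pfilter F -> closed_under_conv F ->
  exists p, [/\ ultra p, F `<=` p & conv p p = p].
Proof.
move=> pF sF.
have [|H [pH FH sH Hmax]] := maximal_filter pF sF.
  move=> C [F0 CF0] totC CP r u ur uu Cr Cu X [F' CF' F'X].
  have [_ _] := CP _ CF'; apply => //.
    by move=> Y F'Y; apply: Cr; exists F'.
  by move=> Y F'Y; apply: Cu; exists F'.
have [p up Hp] := ultra_extend pH.
case: (pH) => HT H0 HI HS; case: (up) => -[pT p0 pI pS] pd.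
pose H' := [set X | H [set s | p [set t | X (s ++ t)]]].
have pH' : pfilter H'.
  split => [||X Y|X Y XY]; rewrite /H' /=.
  - by apply: HS HT => s _ /=; apply: pS pT.
  - by move=> K; apply: H0; apply: HS K => s /=; apply: p0.
  - by move=> K1 K2; apply: HS (HI _ _ K1 K2) => s /= [L1 L2]; exact: pS (pI _ _ L1 L2).
  - by apply: HS => s /=; apply: pS => t /XY.
have HH' : H `<=` H'.
  move=> X HX; apply: (@filter_ultraP _ H) => // r ur Hr.
  by have := sH r p ur up Hr Hp X HX.
have H'E : H' = H.
  apply: Hmax => // r u ur uu H'r H'u X.
  have [r1 [ur1 Hr1 <-]] := conv_divide pH up ur H'r.
  have [u1 [uu1 Hu1 <-]] := conv_divide pH up uu H'u.
  move=> H'X; rewrite conv_assoc.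
  have Hc : H `<=` conv (conv r1 p) u1.
    exact: (sH _ _ (conv_ultra ur1 up) uu1 (sH _ _ ur1 up Hr1 Hp) Hu1).
  exact: Hc.
have [|r [ur Hr rp]] := conv_divide pH up up.
  by move=> X; rewrite -[H _]/(H' X) H'E; apply: Hp.
pose K := [set Z | forall r', ultra r' -> H `<=` r' -> conv r' p = p -> r' Z].
have pK : pfilter K.
  split => [r' [[]]//||X Y KX KY r' ur' Hr' rp'|X Y XY KX r' ur' Hr' rp'].
  - by move=> /(_ r ur Hr rp); case: ur => [[]].
  - by apply: ultraI => //; [apply: KX|apply: KY].
  - by apply: ultraS (KX _ ur' Hr' rp').
have HK : H `<=` K by move=> X HX r' _ Hr' _; apply: Hr'.
have Kp u : ultra u -> K `<=` u -> conv u p = p.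
  move=> uu Ku; apply/esym/ultra_max => //; first by case: (conv_ultra uu up).
  move=> X pX; apply: Ku => r' ur' Hr' rp'.
  by rewrite -rp' in pX.
have KE : K = H.
  apply: Hmax => // r1 r2 u1 u2 K1 K2 X KX; apply: KX; [exact: conv_ultra| |].
    by apply: (sH _ _ u1 u2); exact: (subset_trans HK).
  by rewrite -conv_assoc (Kp r2) // Kp.
exists p; split => //; first by move=> X /FH /Hp.
by apply: Kp => //; rewrite KE.
Qed.

End UltrafilterConvolution.

(** * The Carlson-Simpson theorem from idempotent ultrafilters *)

Section CarlsonSimpson.
Local Open Scope classical_set_scope.
Variable A : finType.
Implicit Types (a : A) (w : seq (option A)).
Local Notation M := (seq (option A)).

Definition subst_var a w : seq A := [seq odflt a x | x <- w].

Let sub a w : M := map Some (subst_var a w).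
Let cst : set M := [set w | None \notin w].
Let push a (U : set (set M)) : set (set M) := [set X | U [set w | X (sub a w)]].

Let sub_cat a w1 w2 : sub a (w1 ++ w2) = sub a w1 ++ sub a w2.
Proof. by rewrite /sub /subst_var !map_cat. Qed.

Let cst_sub a w : cst (sub a w).
Proof. by rewrite /cst /=; apply/mapP => -[]. Qed.

Let sub_cst a w : cst w -> sub a w = w.
Proof.
rewrite /cst /= => cw; rewrite /sub /subst_var -map_comp -[RHS]map_id.
by apply/eq_in_map => -[x|] //= wN; rewrite wN in cw.
Qed.

Let push_ultra a U : ultra U -> ultra (push a U).
Proof.
case=> -[UT U0 UI US] Ud; split; [split|] => [||X Y|X Y XY|X] //=.
- exact: UI.
- by apply: US => w; apply: XY.
- exact: Ud.
Qed.

Let push_conv a r u : push a (conv r u) = conv (push a r) (push a u).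
Proof.
apply/seteqP; split => X; rewrite /push /conv /=; congr (r _); apply/funext => s;
  congr (u _); apply/funext => t /=; by rewrite sub_cat.
Qed.

Let principal (C : set M) : set (set M) := [set X | C `<=` X].

Let principal_pfilter C : C !=set0 -> pfilter (principal C).
Proof.
case=> x Cx; split => [||X Y|X Y XY] //=.
- by move=> H; apply: (H x).
- by move=> CX CY y Cy; split; [apply: CX|apply: CY].
- by move=> CX; apply: subset_trans XY.
Qed.

(* [p] is an idempotent in a minimal left ideal of the ultrafilters on constant
   words, and [q <= p] an idempotent on variable words; substituting a letter in
   [q] gives an idempotent below [p], which is [p] by minimality. *)
Lemma variable_word_ultrafilters : exists p q : set (set M),
  [/\ ultra p, ultra q, conv p q = q, q [set w | None \in w] &
      forall a X, p X -> q [set w | X (map Some (subst_var a w))]].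
Proof.
(* Closed sets of stable filters are left ideals under ultrafilters on constant words, so a maximal
   stable [F] gives a minimal left ideal. *)
pose stable (F : set (set M)) :=
  forall s X, cst s -> F X -> F [set t | X (s ++ t)].
have cst0 : cst !=set0 by exists [::].
have cst_cat w1 w2 : cst w1 -> cst w2 -> cst (w1 ++ w2).
  by rewrite /cst /= mem_cat => /negbTE-> /negbTE->.
have [||F [pF F0 sF Fmax]] := maximal_filter (principal_pfilter cst0)
    (P := stable).
- by move=> s X cs cX t ct /=; apply: cX; apply: cst_cat.
- move=> C _ _ CP s X cs [F CF FX]; exists F => //.
  by have [_ _] := CP _ CF; apply.
have left_ideal r u : ultra r -> r cst -> F `<=` u -> F `<=` conv r u.
  move=> ur rc Fu X FX; rewrite /conv /=; apply: (ultraS ur _ rc) => s cs /=.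
  by apply: Fu; apply: sF.
have F_cst r : F `<=` r -> r cst by apply; apply: F0.
have [|p [up Fp pp]] := idempotent_ultra pF.
  by move=> r u ur uu Fr Fu; apply: (left_ideal) => //; apply: F_cst.
have minimal u v : ultra u -> ultra v -> F `<=` u -> F `<=` v ->
    exists2 r, ultra r & conv r u = v.
  move=> uu uv Fu Fv.
  have [|r [ur _ <-]] := conv_divide (principal_pfilter cst0) uu uv; last first.
    by exists r.
  pose F' := [set X | forall s, cst s -> u [set t | X (s ++ t)]].
  have FF' : F `<=` F' by move=> X FX s cs; apply: Fu; apply: sF.
  move=> X cX; apply: Fv; rewrite -(Fmax F') //.
  - case: uu => -[uT u0 uI uS] ud; split => [s _||X1 X2 K1 K2 s cs|X1 X2 X12 K s cs] //=.
    + by move=> /(_ [::] isT).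
    + by apply: uI; [apply: K1|apply: K2].
    + by apply: uS (K s cs) => t; apply: X12.
  - move=> s X1 cs K s1 cs1 /=.
    by under eq_set do rewrite catA; apply: K; apply: cst_cat.
have pc : p cst by exact: F_cst.
pose var : set M := [set w | None \in w].
have var0 : var !=set0 by exists [:: None].
have var_catl w1 w2 : var w1 -> var (w1 ++ w2) by rewrite /var /= mem_cat => ->.
have var_catr w1 w2 : var w2 -> var (w1 ++ w2).
  by rewrite /var /= mem_cat orbC => ->.
(* The filter of all products [conv r p] with [r] an ultrafilter on variable words. An idempotent
   [q0] among them absorbs [p] on the right, and therefore [conv p q0] is idempotent as well. *)
pose G := [set X | forall s, var s -> p [set t | X (s ++ t)]].
case: (up) => -[pT p0 pI pS] pd.
have pG : pfilter G.
  split => [s _||X1 X2 K1 K2 s cs|X1 X2 X12 K s cs] //=.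
  - by move=> /(_ [:: None] isT).
  - by apply: pI; [apply: K1|apply: K2].
  - by apply: pS (K s cs) => t; apply: X12.
have Gvar : G var.
  by move=> s vs; apply: pS pT => t _ /=; apply: var_catl.
have [|q0 [uq0 Gq0 q0q0]] := idempotent_ultra pG.
  move=> r u ur uu Gr Gu X GX; rewrite /conv /=.
  apply: (ultraS ur _ (Gr _ Gvar)) => s vs /=; apply: Gu => t vt /=.
  by under eq_set do rewrite catA; apply: GX; apply: var_catl.
have [|r0 [ur0 r0v r0p]] := conv_divide (principal_pfilter var0) up uq0.
  by move=> X vX; apply: Gq0.
have q0p : conv q0 p = q0 by rewrite -r0p -conv_assoc pp.
have uq : ultra (conv p q0) by exact: conv_ultra.
have qq : conv (conv p q0) (conv p q0) = conv p q0.
  by rewrite -conv_assoc (conv_assoc q0) q0p q0q0.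
exists p, (conv p q0); split => //.
- by rewrite conv_assoc pp.
- rewrite /conv /=; apply: pS pT => s _ /=.
  by apply: (ultraS uq0 _ (Gq0 _ Gvar)) => t; apply: var_catr.
move=> a; suff E : push a (conv p q0) = p by move=> X; rewrite -{1}E.
have pushp : push a p = p.
  apply/esym/ultra_max => //; first by case: (push_ultra a up).
  move=> X pX; apply: pS (pI _ _ pX pc) => w [Xw cw] /=; by rewrite sub_cst.
have eE : push a (conv p q0) = conv p (push a q0) by rewrite push_conv pushp.
have ue := push_ultra a uq.
have Fe : F `<=` push a (conv p q0).
  rewrite eE; apply: (left_ideal) => //.
  rewrite -r0p push_conv pushp; apply: (left_ideal) => //; first exact: push_ultra.
  by apply: (ultraS ur0 _ (r0v _ (fun _ h => h))) => w _ /=; apply: cst_sub.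
(* Write [e] for [push a (conv p q0)]: an idempotent of the minimal left ideal with [conv p e = e].
   From [conv r e = p] follows [p = conv p e = e]. *)
have [r ur rE] := minimal _ _ ue up Fe Fp.
have pe : conv p (push a (conv p q0)) = p.
  by rewrite -{1}rE -conv_assoc -push_conv qq rE.
by rewrite -[RHS]pe {2}eE conv_assoc pp -eE.
Qed.

(** Each block is a variable word that begins with its variable; this becomes the
    immediate-successor condition of [strong]. *)
Fixpoint run (y : nat -> seq (option A)) (k : nat) (s : seq A) : seq A :=
  if s is a :: s' then a :: subst_var a (y k) ++ run y k.+1 s' else [::].

Theorem carlson_simpson (I : finType) (chi : seq A -> I) :
  exists (u : seq A) (y : nat -> seq (option A)) (i : I),
    forall s : seq A, chi (u ++ run y 0 s) = i.
Proof.
have [p [q [up uq pq qv sub_pq]]] := variable_word_ultrafilters.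
(* Words are coloured through their part before the first variable. The words [w n] found below are
   recut at that place, so that every block begins with the variable. *)
pose pre w := pmap idfun (take (index None w) w).
have [i Yi] := ultra_partition (fun w => chi (pre w)) uq.
pose Y := [set w | chi (pre w) = i].
(* Being continued well by [q]-almost every word passes from [s] to [s ++ subst_var a w] for
   [q]-almost every [w], because [q = conv p q] and substitution carries [q] to [p]. *)
pose Ys (s : seq A) := q [set w | Y (map Some s ++ w)].
have Ys_p s : Ys s -> p [set w | q [set v | Y (map Some s ++ (w ++ v))]].
  by rewrite /Ys -{1}pq.
have step (L : seq (seq A)) : exists w, (forall s, s \in L -> Ys s) ->
   [/\ None \in w, forall s, s \in L -> Y (map Some s ++ w) &
      forall s a, s \in L -> Ys (s ++ subst_var a w)].
  have [LY|nLY] := pselect (forall s, s \in L -> Ys s); last by exists [::].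
  have H1 := ultra_all uq (A := fun s => [set w | Y (map Some s ++ w)]) LY.
  pose L2 := [seq (s, a) | s <- L, a <- enum A].
  have H2 : q [set w | forall sa, sa \in L2 -> Ys (sa.1 ++ subst_var sa.2 w)].
    apply: (ultra_all uq (A := fun sa => [set w | Ys (sa.1 ++ subst_var sa.2 w)])).
    move=> _ /allpairsP[[s a] [/= sL _ ->]] /=.
    have /Ys_p/(sub_pq a) := LY s sL.
    apply: (ultraS uq) => w /=; rewrite /Ys.
    by under eq_set do rewrite catA -map_cat.
  have H := ultraI uq qv (ultraI uq H1 H2).
  have [w [wv [w1 w2]]] : [set w | None \in w] `&`
     ([set w | forall s, s \in L -> Y (map Some s ++ w)] `&`
      [set w | forall sa, sa \in L2 -> Ys (sa.1 ++ subst_var sa.2 w)]) !=set0.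
    apply/set0P; apply/negP => /eqP E; rewrite E in H.
    by case: uq => -[].
  exists w => _; split => // s a sL; apply: (w2 (s, a)).
  by apply/allpairsP; exists (s, a); rewrite mem_enum.
have [f fP] := choice step.
pose nextL L := [seq s ++ subst_var a (f L) | s <- L, a <- enum A].
pose L n := iter n nextL [:: [::]].
have LY n : forall s, s \in L n -> Ys s.
  elim: n => [|n IH] s; first by rewrite inE => /eqP ->.
  move=> /allpairsP[[s' a] [/= s'L _ ->]].
  by have [_ _] := fP _ IH; apply.
pose w n := f (L n).
pose u n := pre (w n).
pose v n := drop (index None (w n)).+1 (w n).
have wE n : w n = map Some (u n) ++ None :: v n.
  have [wN _ _] := fP _ (LY n).
  rewrite -{1}(cat_take_drop (index None (w n)) (w n)); congr (_ ++ _).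
    rewrite /u /pre.
    have : None \notin take (index None (w n)) (w n).
      by rewrite in_take // ltnn.
    by elim: (take _ _) => //= -[b|] t IHt; rewrite inE //= => /IHt {1}->.
  by rewrite (drop_nth None) ?index_mem // nth_index.
have preE s n : pre (map Some s ++ w n) = s ++ u n.
  rewrite /pre wE !catA -map_cat index_cat ifN; last by apply/mapP => -[].
  rewrite /= addn0 take_size_cat //.
  by elim: (s ++ u n) => //= x t ->.
pose y n := v n ++ map Some (u n.+1).
have substS a t : subst_var a (map Some t) = t.
  by rewrite /subst_var -map_comp map_id.
have runE s : forall t n, t \in L n ->
    exists2 t', t' \in L (n + size s) & t ++ u n ++ run y n s = t' ++ u (n + size s).
  elim: s => [|a s IH] t n tL /=; first by exists t; rewrite ?addn0 // cats0.
  have [|t' t'L E] := IH (t ++ subst_var a (w n)) n.+1.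
    by apply/allpairsP; exists (t, a); rewrite mem_enum.
  rewrite addnS -addSn; exists t' => //; rewrite -E wE.
  rewrite /y /subst_var !map_cat /= -!/(subst_var _ _) !substS.
  by rewrite -!catA.
exists (u 0), y, i => s.
have [|t tL] := runE s [::] 0; first by rewrite inE.
rewrite /= => ->; rewrite add0n in tL *.
have [_ Yw _] := fP _ (LY (size s)).
by have := Yw _ tL; rewrite /Y /= preE.
Qed.

End CarlsonSimpson.

(** * Strong embeddings, codes and Milliken's theorem *)

Notation node := (seq bool).

Definition strong (f : node -> node) : Prop :=
  (forall s b, prefix (rcons (f s) b) (f (rcons s b))) /\
  (forall s t, size s = size t -> size (f s) = size (f t)).

Lemma strong_id : strong (fun s => s).
Proof. by split=> // s b; apply: prefix_refl. Qed.

Lemma strong_prefix f s t : strong f -> prefix s t -> prefix (f s) (f t).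
Proof.
move=> [f1 _] /prefixP[w ->]; elim/last_ind: w => [|w b IH].
  by rewrite cats0; apply: prefix_refl.
rewrite -rcons_cat; apply: prefix_trans IH _.
by apply: prefix_trans (prefix_rcons _ b) _.
Qed.

Lemma strong_comp f g : strong f -> strong g -> strong (f \o g).
Proof.
move=> sf sg; have [f1 f2] := sf; have [g1 g2] := sg.
split=> [s b|s t st] /=; last by apply/f2/g2.
by apply: prefix_trans (f1 _ _) _; apply: strong_prefix.
Qed.

Definition fixes_below (j : nat) (g : node -> node) : Prop :=
  strong g /\ forall s, size s < j -> g s = s.

(** The limit of [g_0 \o ... \o g_(n-1)] exists because [g_n] fixes the words shorter than [n].
    [P j] is secured at stage [j] and survives the later factors. *)
Lemma fusion (P : nat -> (node -> node) -> Prop) :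
    (forall j f, strong f -> exists2 g, fixes_below j g & P j (f \o g)) ->
    (forall j f g, strong f -> P j f -> fixes_below j g -> P j (f \o g)) ->
  exists2 f, strong f & forall j, P j f.
Proof.
move=> step stable.
have step' (x : nat * (node -> node)) : exists g : node -> node,
    strong x.2 -> fixes_below x.1 g /\ P x.1 (x.2 \o g).
  case: x => j f; have [sf|nsf] := pselect (strong f); last by exists f.
  by have [g g1 g2] := step j f sf; exists g.
have [G GP] := choice step'.
pose F := fix F n := if n is n'.+1 then F n' \o G (n', F n') else fun s => s.
have sF n : strong (F n).
  elim: n => [|n IH]; first exact: strong_id.
  by apply: strong_comp => //; have [[]] := GP (n, F n) IH.
pose g n := G (n, F n).
have gfix n : fixes_below n (g n) by have [] := GP (n, F n) (sF n).
pose H n := fix H k := if k is k'.+1 then H k' \o g (n + k') else fun s => s.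
have sH n k : strong (H n k).
  elim: k => [|k IH]; first exact: strong_id.
  by apply: strong_comp => //; have [] := gfix (n + k).
have FH n k : F (n + k) = F n \o H n k.
  elim: k => [|k IH]; first by rewrite addn0.
  apply/funext => s; rewrite addnS -[RHS]/((F n \o H n k) (g (n + k) s)).
  by rewrite -IH.
have Hfix n k s : size s < n -> H n k s = s.
  move=> sn; elim: k => //= k IH; rewrite (gfix _).2 //.
  by rewrite (leq_trans sn) // leq_addr.
have Hlarge n k s : (size s).+1 - n <= k -> H n k s = H n ((size s).+1 - n) s.
  move=> sk; rewrite -(subnK sk); elim: (k - _) => //= i IH.
  by rewrite (gfix _).2 //; lia.
(* The tail of the infinite composition from stage [n] on. *)
pose h n s := H n ((size s).+1 - n) s.
have hfix n : fixes_below n (h n).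
  split; last by move=> s; apply: Hfix.
  split=> [s b|s t st]; last by rewrite /h st; apply: (sH _ _).2.
  rewrite {2}/h; set k := _ - n.
  by rewrite {1}/h -(@Hlarge n k) ?(sH _ _).1 // /k size_rcons; lia.
pose f s := F (size s).+1 s.
have fE n : f = F n \o h n.
  apply/funext => s; rewrite -[RHS]/(F n (h n s)) /f /h.
  have [ns|ns] := leqP n (size s).+1.
    by have := FH n ((size s).+1 - n); rewrite subnKC // => ->.
  have := FH (size s).+1 (n - (size s).+1); rewrite subnKC 1?ltnW // => ->.
  by rewrite (eqP (ltnW ns)) -[RHS]/(F _ (H _ _ s)) Hfix.
exists f; first by have -> := fE 0; apply: strong_comp => //; case: (hfix 0).
move=> j; rewrite (fE j.+1); apply: stable => //.
  by have [_] := GP (j, F j) (sF j).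
by have [h1 h2] := hfix j.+1; split => // s sj; apply: h2; apply: ltnW.
Qed.

(* A state lists, in lexicographic order, the branches of a finite antichain cut
   at some level; the flag tells whether a branch is still alive there. *)
Notation state := (seq (bool * node)).

Definition grow (n : nat) (x y : bool * node) : bool :=
  (x.1 == y.1) &&
  (if x.1 then prefix x.2 y.2 && (size y.2 == size x.2 + n) else x.2 == y.2).

Definition pass0 (I : state) : state :=
  [seq (x.1, if x.1 then rcons x.2 false else x.2) | x <- I].

Definition fork (b : bool) (t : node) : state :=
  if b then [:: (true, rcons t false); (true, rcons t true)] else [:: (false, t)].

(* [(true, p)] splits the [p]-th branch of the state, [(false, p)] ends it. The other
   living branches take the letter [false] at that level, and arbitrary letters
   between two moves. *)
Notation move := (bool * nat)%type.

Inductive completes : state -> seq move -> seq node -> Prop :=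
| completes_done (I : state) :
    all (fun x => ~~ x.1) I -> completes I [::] (map snd I)
| completes_grow n (I J : state) sigma D :
    all2 (grow n) I J -> completes J sigma D -> completes I sigma D
| completes_move b (I1 I2 : state) t sigma D :
    completes (pass0 I1 ++ fork b t ++ pass0 I2) sigma D ->
    completes (I1 ++ (true, t) :: I2) ((b, size I1) :: sigma) D.

Definition map_state (f : node -> node) (I : state) : state :=
  [seq (x.1, f x.2) | x <- I].

Definition level (j : nat) (I : state) : bool :=
  all (fun x => if x.1 then size x.2 == j else size x.2 < j) I && uniq I.

Lemma cat_all2 (A B : Type) (r : A -> B -> bool) s1 s2 t1 t2 :
  all2 r s1 t1 -> all2 r s2 t2 -> all2 r (s1 ++ s2) (t1 ++ t2).
Proof. by elim: s1 t1 => [|x s1 IH] [|y t1] //= /andP[-> /IH{}IH] /IH. Qed.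

Lemma grow_trans n m x y z : grow n x y -> grow m y z -> grow (n + m) x z.
Proof.
case: x y z => [[] x] [[] y] [[] z] //=; rewrite /grow /=.
  by move=> /andP[xy /eqP sy] /andP[yz /eqP sz]; rewrite (prefix_trans xy) //= sz sy addnA.
by move=> /eqP-> /eqP->.
Qed.

Lemma all2_grow_trans n m (I J K : state) :
  all2 (grow n) I J -> all2 (grow m) J K -> all2 (grow (n + m)) I K.
Proof.
elim: I J K => [|x I IH] [|y J] [|z K] //= /andP[xy IJ] /andP[yz JK].
by rewrite (grow_trans xy yz) (IH _ _ IJ JK).
Qed.

Lemma all2_grow0 (I : state) : all2 (grow 0) I I.
Proof.
elim: I => //= -[[] t] I ->; rewrite /grow /= ?eqxx ?andbT //.
by rewrite prefix_refl addn0 eqxx.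
Qed.

(** Consecutive growth steps merge into one, which puts derivations into a normal form. *)
Lemma completes_moveE b p I sigma D : completes I ((b, p) :: sigma) D ->
  exists n I1 t I2, [/\ all2 (grow n) I (I1 ++ (true, t) :: I2), p = size I1 &
    completes (pass0 I1 ++ fork b t ++ pass0 I2) sigma D].
Proof.
move E: (_ :: _) => s c; elim: c E => // [n I' J s' D' IJ _ IH E|b' I1 I2 t s' D' c _].
  have [m [I1 [t [I2 [JJ -> c]]]]] := IH E.
  by exists (n + m), I1, t, I2; split => //; apply: all2_grow_trans JJ.
by case=> -> -> ->; exists 0, I1, t, I2; split => //; apply: all2_grow0.
Qed.

Lemma completes_nilE I D : completes I [::] D -> all (fun x => ~~ x.1) I ->
  D = map snd I.
Proof.
move E: [::] => s c; elim: c E => // n I' J s' D' IJ _ IH E dI.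
have EJ : I' = J.
  elim: I' J IJ dI {IH} => [|[[] x] I' IH] [|[[] y] J] //= /andP[/andP[_ /eqP/= ->]].
  by move=> /IH{}IH /IH ->.
by rewrite EJ in dI *; apply: IH.
Qed.

Definition live_at (j : nat) (I : state) : bool :=
  all (fun x => x.1 ==> (size x.2 == j)) I.

Lemma level_live_at j I : level j I -> live_at j I.
Proof. by move=> /andP[/allP H _]; apply/allP => -[[] t] /H. Qed.

Lemma live_at_grow j n I J : all2 (grow n) I J -> live_at j I -> live_at (j + n) J.
Proof.
elim: I J => [|[b x] I IH] [|[b' y] J] //= /andP[/andP[/eqP/= <-]].
case: b => /= [/andP[_ /eqP->] IJ /andP[/eqP-> /(IH _ IJ)->]|_ IJ]; last exact: IH.
by rewrite eqxx.
Qed.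

Lemma live_at_move j b t I1 I2 : live_at j (I1 ++ (true, t) :: I2) ->
  live_at j.+1 (pass0 I1 ++ fork b t ++ pass0 I2).
Proof.
have live0 I : live_at j I -> live_at j.+1 (pass0 I).
  elim: I => //= -[[] x] I IH //= /andP[/eqP sx /IH jI].
  by apply/andP; rewrite size_rcons sx.
rewrite /live_at !all_cat /= => /and3P[/live0 H1 /eqP jt /live0 H2].
apply/and3P; split => //.
by case: b; rewrite /= ?size_rcons ?jt ?eqxx.
Qed.

Lemma strong_grow f j n I J : strong f -> live_at j I -> all2 (grow n) I J ->
  exists m, all2 (grow m) (map_state f I) (map_state f J).
Proof.
move=> sf; have [_ f2] := sf; pose l i := size (f (nseq i false)).
have lE t : size (f t) = l (size t) by apply: f2; rewrite size_nseq.
exists (l (j + n) - l j); elim: I J H H0 => [|[b x] I IH] [|[b' y] J] //=.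
move=> /andP[jx jI] /andP[/andP[/eqP/= <-]]; case: b jx => /= [/eqP jx|_].
  move=> /andP[xy /eqP sy] IJ; rewrite IH // andbT /grow /= strong_prefix //=.
  have := size_prefix (strong_prefix sf xy).
  by rewrite !lE sy jx => /subnKC->.
by move=> /eqP<- IJ; rewrite IH // andbT /grow /=.
Qed.

(** The image of a split need not be a split of the image, since [f (rcons t c)] may extend
    [rcons (f t) c] properly. As [f] respects levels, one growth step common to all branches repairs
    this. *)
Lemma strong_fork_grow f j b t I1 I2 : strong f ->
    live_at j (I1 ++ (true, t) :: I2) -> exists m, all2 (grow m)
      (pass0 (map_state f I1) ++ fork b (f t) ++ pass0 (map_state f I2))
      (map_state f (pass0 I1 ++ fork b t ++ pass0 I2)).
Proof.
move=> sf; have [f1 f2] := sf; pose l i := size (f (nseq i false)).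
have lE s : size (f s) = l (size s) by apply: f2; rewrite size_nseq.
have growS s c : size s = j ->
    grow (l j.+1 - (l j).+1) (true, rcons (f s) c) (true, f (rcons s c)).
  move=> sj; rewrite /grow /= f1 /=.
  have := size_prefix (f1 s c).
  by rewrite size_rcons !lE size_rcons sj => /subnKC->.
have grow0 I : live_at j I -> all2 (grow (l j.+1 - (l j).+1))
    (pass0 (map_state f I)) (map_state f (pass0 I)).
  elim: I => //= -[b' x] I IH /= /andP[jx /IH->]; rewrite andbT.
  by case: b' jx => [/eqP/growS//|_]; rewrite /grow /=.
rewrite /live_at all_cat /= => /and3P[/grow0 g1 /eqP jt /grow0 g2].
exists (l j.+1 - (l j).+1); rewrite /map_state !map_cat.
apply: cat_all2 => //; apply: cat_all2 => //.
by case: b; rewrite /= ?growS //= /grow /= eqxx.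
Qed.

Lemma strong_completes f j I sigma D : strong f -> live_at j I ->
  completes I sigma D -> completes (map_state f I) sigma (map f D).
Proof.
move=> sf jI c; elim: c j jI => [J dJ|n J K s E JK _ IH|b I1 I2 t s E _ IH] j jI.
- have -> : [seq f i | i <- [seq i.2 | i <- J]] = [seq i.2 | i <- map_state f J].
    by rewrite -!map_comp.
  by apply: completes_done; rewrite all_map.
- have [m g] := strong_grow sf jI JK.
  by apply: completes_grow g _; apply: IH; apply: live_at_grow JK jI.
- rewrite /map_state map_cat /= -(size_map (fun x => (x.1, f x.2)) I1).
  have [m g] := strong_fork_grow b sf jI.
  apply: completes_move; apply: completes_grow g _.
  by apply: IH; apply: live_at_move jI.
Qed.

(** * The Halpern-Lauchli theorem for branches of equal length *)

Definition row k (i : nat) (v : seq (k.-tuple bool)) : node :=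
  [seq nth false (val c) i | c <- v].

(** A word of columns is [k] branches read in parallel. Substitution into variable words acts on
    each row separately, so every row undergoes its own strong embedding, with common level
    sizes. *)
Lemma halpern_lauchli k (C : finType) (chi : seq (k.-tuple bool) -> C) :
  exists (F : nat -> node -> node) (Phi : seq (k.-tuple bool) -> seq (k.-tuple bool)) (c : C),
    [/\ forall i, strong (F i),
        forall i i' s s', size s = size s' -> size (F i s) = size (F i' s'),
        forall v, chi (Phi v) = c &
        forall i v, row i (Phi v) = F i (row i v)].
Proof.
have [u [y [c uyc]]] := carlson_simpson chi.
pose rowv i b (w : seq (option (k.-tuple bool))) :=
  [seq if x is Some t then nth false (val t) i else b | x <- w].
pose rrun i := fix rrun n (s : node) :=
  if s is b :: s' then b :: rowv i b (y n) ++ rrun n.+1 s' else [::].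
pose F i s := row i u ++ rrun i 0 s.
have size_rrun i i' s s' n : size s = size s' -> size (rrun i n s) = size (rrun i' n s').
  elim: s s' n => [|b s IH] [|b' s'] n //= [/IH E].
  by rewrite !size_cat !size_map E.
have sF i i' s s' : size s = size s' -> size (F i s) = size (F i' s').
  by move=> E; rewrite !size_cat !size_map (size_rrun i i' _ _ _ E).
exists F, (fun v => u ++ run y 0 v), c; split => //.
- move=> i; split; last by move=> s t; apply: sF.
  move=> s b; have rrunE n : rrun i n (rcons s b) = rrun i n s ++ b :: rowv i b (y (n + size s)).
    elim: s n => [|a s IH] n /=; first by rewrite addn0 cats0.
    by rewrite IH addnS addSn catA.
  apply/prefixP; exists (rowv i b (y (0 + size s))).
  by rewrite /F rrunE catA cat_rcons.
- move=> i v; rewrite /row map_cat; congr (_ ++ _).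
  elim: v 0 => //= a v IH n; rewrite map_cat IH; congr (_ :: _ ++ _).
  by rewrite /subst_var -map_comp; apply: eq_map => -[].
Qed.

Lemma strong_lt_size f s t : strong f -> size s < size t -> size (f s) < size (f t).
Proof.
move=> sf st; have := strong_prefix sf (prefix_take t (size s).+1).
have -> : take (size s).+1 t = rcons (take (size s) t) (nth false t (size s)).
  by rewrite (take_nth false).
move=> /size_prefix; apply: leq_trans.
have := size_prefix (sf.1 (take (size s) t) (nth false t (size s))).
rewrite size_rcons; apply: leq_trans.
by rewrite ltnS (sf.2 _ (take (size s) t)) // size_takel // ltnW.
Qed.

Lemma strong_inj f : strong f -> injective f.
Proof.
move=> sf s t; elim/last_ind: s t => [|s b IH] t E.
  case: t E => //= b t E.
  by have := strong_lt_size (s := [::]) (t := b :: t) sf isT; rewrite E ltnn.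
case/lastP: t E => [|t c] E.
  have := strong_lt_size (s := [::]) (t := rcons s b) sf.
  by rewrite E ltnn size_rcons => /(_ isT).
have [|n|n] := ltngtP (size s) (size t).
- move=> n; have := strong_lt_size (s := rcons s b) (t := rcons t c) sf.
  by rewrite E ltnn !size_rcons ltnS => /(_ n).
- have := strong_lt_size (s := rcons t c) (t := rcons s b) sf.
  by rewrite E ltnn !size_rcons ltnS => /(_ n).
have := sf.1 s b; rewrite E => /prefixP[w1 E1].
have /prefixP[w2 E2] := sf.1 t c.
have : rcons (f s) b = rcons (f t) c.
  apply/eqP; move/eqP: E2; rewrite E1 eqseq_cat ?size_rcons; last by rewrite (sf.2 _ _ n).
  by case/andP.
by move=> /rcons_inj[/IH-> ->].
Qed.

Lemma level_map j f I : strong f -> level j I ->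
  level (size (f (nseq j false))) (map_state f I).
Proof.
move=> sf /andP[/allP H u]; rewrite /level map_inj_uniq ?u ?andbT; last first.
  by move=> [a s] [b t] [-> /(strong_inj sf) ->].
rewrite all_map; apply/allP => -[[] t] /H /=.
  by move=> /eqP jt; apply/eqP/sf.2; rewrite size_nseq.
by move=> jt; apply: strong_lt_size; rewrite ?size_nseq.
Qed.

Lemma level_grow j n I J : level j I -> all2 (grow n) I J -> level (j + n) J.
Proof.
move=> lI IJ; have /andP[aI uI] := lI; apply/andP; split.
  elim: I J aI IJ {lI uI} => [|[b x] I IH] [|[b' y] J] //= /andP[bx /IH{}IH].
  case/andP => /andP[/= /eqP<- +] /IH ->; rewrite andbT.
  case: b bx => /= [/eqP<- /andP[_]//|xj /eqP<-].
  by rewrite (leq_trans xj) // leq_addr.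
apply: (map_uniq (f := fun x => (x.1, take j x.2))).
suff <- : I = [seq (x.1, take j x.2) | x <- J] by [].
elim: I J aI IJ {lI uI} => [|[b x] I IH] [|[b' y] J] //= /andP[bx /IH{}IH].
case/andP => /andP[/= /eqP<- +] /IH <-.
case: b bx => /= [/eqP<- /andP[/prefixP[w ->] _]|xj /eqP<-].
  by rewrite take_size_cat.
by rewrite take_oversize // ltnW.
Qed.

Lemma level_move j b t I1 I2 : level j (I1 ++ (true, t) :: I2) ->
  level j.+1 (pass0 I1 ++ fork b t ++ pass0 I2).
Proof.
move=> /andP[]; rewrite all_cat /= => /and3P[a1 /eqP jt a2] u.
have lev I : all (fun x => if x.1 then size x.2 == j else size x.2 < j) I ->
    all (fun x => if x.1 then size x.2 == j.+1 else size x.2 < j.+1) (pass0 I).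
  elim: I => //= -[[] x] I IH /= /andP[jx /IH->]; rewrite andbT.
    by rewrite size_rcons.
  exact: ltnW.
pose psi (x : bool * node) := (j <= size x.2, take j x.2).
have psiE I : all (fun x => if x.1 then size x.2 == j else size x.2 < j) I ->
    map psi (pass0 I) = I.
  elim: I => //= -[[] x] I IH /= /andP[jx /IH->]; congr (_ :: _); rewrite /psi /=.
    by rewrite size_rcons -(eqP jx) leqnSn -cats1 take_size_cat.
  by rewrite leqNgt jx take_oversize // ltnW.
have u1 x : psi x = (true, t) -> uniq (x :: pass0 I1 ++ pass0 I2).
  move=> px; apply: (map_uniq (f := psi)); rewrite map_cons map_cat px !psiE //.
  by rewrite -cat1s uniq_catCA.
apply/andP; split.
  rewrite !all_cat !lev // andbT /=.
  by case: b; rewrite /= ?size_rcons jt ?eqxx ?ltnS ?leqnn.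
have psib c : psi (true, rcons t c) = (true, t).
  by rewrite /psi /= size_rcons jt leqnSn -cats1 take_cat jt ltnn subnn cats0.
rewrite uniq_catCA; case: b; rewrite /fork; last first.
  by apply: u1; rewrite /psi /= jt leqnn take_oversize // jt.
have /= := u1 (true, rcons t false) (psib _).
have /= := u1 (true, rcons t true) (psib _).
move=> /andP[-> _] /andP[n0 ->]; rewrite !andbT inE negb_or n0 andbT.
by apply/eqP => -[/rcons_inj[]].
Qed.

Definition extend (I : state) (v : seq ((size I).-tuple bool)) : state :=
  [seq (x.1, if x.1 then x.2 ++ row (index x I) v else x.2) | x <- I].

Lemma grow_extend n I J : uniq I -> all2 (grow n) I J ->
  exists v, J = @extend I v.
Proof.
move=> uI; rewrite all2E => /andP[/eqP sIJ /allP IJ].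
pose d : bool * node := (false, [::]).
exists (mkseq (fun l => [tuple nth false (nth d J i).2 (size (nth d I i).2 + l) | i < size I]) n).
apply: (@eq_from_nth _ d); first by rewrite size_map.
move=> i; rewrite -sIJ => iI; rewrite (nth_map d) // index_uniq //.
have /= := IJ (nth d I i, nth d J i).
have -> : (nth d I i, nth d J i) \in zip I J.
  by rewrite -(nth_zip d d) // mem_nth // size_zip -sIJ minnn.
move=> /(_ isT); rewrite /grow /=.
case EI: (nth d I i) => [a x]; case EJ: (nth d J i) => [b y] /= /andP[/eqP <-].
case: a EI => EI; last by move=> /eqP->.
case/andP => /prefixP[w yw] /eqP; rewrite yw size_cat => /addnI sw.
congr (_, _ ++ _); apply: (@eq_from_nth _ false); first by rewrite !size_map size_iota.
move=> l lw; rewrite (nth_map [tuple of nseq (size I) false]) ?size_mkseq -?sw //.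
rewrite nth_mkseq -?sw // -[i]/(val (Ordinal iI)) -tnth_nth tnth_mktuple /=.
by rewrite EI EJ /= yw nth_cat ltnNge leq_addr /= addKn.
Qed.

(** Nodes above no entry of [I] get the index [size I]; they too are moved by a strong embedding
    with the same level sizes, so the whole map is strong. *)
Definition cone (j : nat) (I : state) (F : nat -> node -> node) (s : node) : node :=
  if size s < j then s else
  take j s ++ F (index (true, take j s) I) (drop j s).

Lemma cone_fixes j I F : (forall i, strong (F i)) ->
    (forall i i' s s', size s = size s' -> size (F i s) = size (F i' s')) ->
  fixes_below j (cone j I F).
Proof.
move=> sF szF; split; last by move=> s sj; rewrite /cone sj.
split=> [s b|s t st]; last first.
  rewrite /cone st; case: ltnP => // jt.
  by rewrite !size_cat !size_takel ?st //; congr (_ + _); apply: szF; rewrite !size_drop st.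
rewrite /cone size_rcons; have [js|js|js] := ltngtP (size s) j.
- have [//|] := ltnP (size s).+1 j; first by rewrite prefix_refl.
  move=> js'; have -> : j = (size s).+1 by lia.
  by rewrite take_oversize ?size_rcons // prefix_prefix.
- rewrite [_.+1 < j]ltnNge (leqW (ltnW js)) /= -[rcons s b]cats1.
  rewrite takel_cat 1?ltnW // drop_cat js cats1.
  by rewrite rcons_cat prefix_catr // eqxx; apply: (sF _).1.
- rewrite -js ltnNge leqnSn /= take_oversize // drop_oversize //.
  rewrite -[rcons s b]cats1 takel_cat // take_size drop_size_cat //.
  by rewrite rcons_cat prefix_catr // eqxx; apply: ((sF _).1 [::] b).
Qed.

Lemma map_cone j I F v w : level j I ->
    (forall i, row i w = F i (row i v)) ->
  map_state (cone j I F) (@extend I v) = @extend I w.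
Proof.
move=> /andP[/allP aI _] H; rewrite /map_state /extend -map_comp.
apply/eq_in_map => -[[] t] /aI /=; rewrite /cone; last by move=> ->.
move=> /eqP jt; rewrite size_cat jt ltnNge leq_addr /=; congr (_, _).
by rewrite take_size_cat // drop_size_cat // H.
Qed.

Lemma level_enum j : exists L : seq state, forall I, level j I -> I \in L.
Proof.
pose FT : finType := (bool * j.-bseq bool)%type.
exists [seq [seq (y.1, bseqval y.2) | y <- bseqval z] | z <- enum {: #|FT|.-bseq FT}].
move=> I /andP[/allP aI uI].
have EI : [seq (y.1, bseqval y.2) | y : FT <- [seq (x.1, insub_bseq j x.2) | x <- I]] = I.
  rewrite -map_comp -[RHS]map_id; apply/eq_in_map => -[b t] /aI /= jt.
  have tj : size t <= j by case: b jt => [/eqP->|/ltnW].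
  by rewrite insubdK.
pose I' : seq FT := [seq (x.1, insub_bseq j x.2) | x <- I].
have sI' : size I' <= #|FT|.
  have /card_uniqP <- : uniq I'.
    by apply: (map_uniq (f := fun y : FT => (y.1, bseqval y.2))); rewrite EI.
  exact: max_card.
by apply/mapP; exists (Bseq sI'); rewrite ?mem_enum.
Qed.

(** * Milliken's theorem for codes *)

Section Milliken.
Variables (C : finType) (chi : seq node -> C).

Definition homogeneous (f : node -> node) (I : state) (sigma : seq move) : Prop :=
  forall D D', completes I sigma D -> completes I sigma D' ->
  chi (map f D) = chi (map f D').

Lemma homogeneous_comp f h sigma : strong h ->
    (forall j I, level j I -> homogeneous f I sigma) ->
  forall j I, level j I -> homogeneous (f \o h) I sigma.
Proof.
move=> sh H j I lI D D' c c'; rewrite (map_comp f h D) (map_comp f h D').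
have lI' := level_map sh lI.
by apply: (H _ _ lI'); apply: (strong_completes sh (level_live_at lI)).
Qed.

(** A word of length [j] is sent to an extension of itself, for the word without its last letter is
    fixed. Hence [h] only adds growth to [I]. *)
Lemma homogeneous_fix f h j I sigma : fixes_below j h -> level j I ->
  homogeneous f I sigma -> homogeneous (f \o h) I sigma.
Proof.
move=> [sh hj] lI H D D'; rewrite (map_comp f h D) (map_comp f h D').
suff c E : completes I sigma E -> completes I sigma (map h E).
  by move=> /c{}c0 /c{}c'; apply: H.
move=> c; have {c} := strong_completes sh (level_live_at lI) c.
apply: (completes_grow (n := size (h (nseq j false)) - j)).
case/andP: lI => aI _; elim: I aI {H} => //= -[[] t] I IH /= /andP[tj /IH->].
  rewrite andbT /grow /=; have pt : prefix t (h t).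
    case/lastP: t tj => [|t b]; first by rewrite prefix0s.
    by rewrite size_rcons => tj; rewrite -{1}(hj t) ?sh.1 -?(eqP tj).
  rewrite pt /= (sh.2 t (nseq j false)) ?size_nseq ?(eqP tj) //.
  by rewrite -(sh.2 t) ?size_nseq ?(eqP tj) // -(eqP tj) subnKC // size_prefix.
by rewrite andbT /grow /= hj.
Qed.

(** By the hypothesis on the shorter code, the final colour depends only on the state in which the
    first move is made, that is, on a word of columns above [I]. Halpern-Lauchli makes this
    colouring of words constant. *)
Lemma homogeneous_cone b p sigma f j I :
    (forall j I, level j I -> homogeneous f I sigma) -> level j I ->
  exists2 g, fixes_below j g & homogeneous (f \o g) I ((b, p) :: sigma).
Proof.
move=> H lI; have /andP[_ uI] := lI.
pose next v D := exists I1 t I2, [/\ @extend I v = I1 ++ (true, t) :: I2, p = size I1 &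
   completes (pass0 I1 ++ fork b t ++ pass0 I2) sigma D].
(* [None] serves the words [v] after which this move leads to no completion. *)
have S v : exists o : option C, forall D, next v D ->
    (exists i, level i (@extend I v)) -> o = Some (chi (map f D)).
  have [[D0 [J1 [u [J2 [E2 s2 c2]]]]]|n0] := pselect (exists D0, next v D0); last first.
    by exists None => D n; case: n0; exists D.
  exists (Some (chi (map f D0))) => D [I1 [t [I2 [E1 s1 c1]]]] [i li]; congr Some.
  have lI1 : level i (I1 ++ (true, t) :: I2) by rewrite -E1.
  move: E2 c2; rewrite E1 => /eqP; rewrite eqseq_cat -?s1 // eqseq_cons.
  case/and3P => /eqP<- /eqP[<-] /eqP<- c2.
  exact: (H _ _ (level_move b lI1)).
have {S} [c cP] := choice S.
have [F [Phi [c0 [sF szF PhiC PhiF]]]] := halpern_lauchli c.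
exists (cone j I F); first exact: cone_fixes.
have [sg gj] := cone_fixes j I sF szF.
suff K D : completes I ((b, p) :: sigma) D -> Some (chi (map (f \o cone j I F) D)) = c0.
  by move=> D D' /K E /K E'; apply: Some_inj; rewrite E E'.
case/completes_moveE => n [I1 [t [I2 [IJ pI cJ]]]].
have lJ := level_grow lI IJ.
have [v vE] := grow_extend uI IJ.
have E : @extend I (Phi v) = map_state (cone j I F) I1 ++
    (true, cone j I F t) :: map_state (cone j I F) I2.
  by rewrite -(map_cone lI (fun i => PhiF i v)) -vE /map_state map_cat.
rewrite (map_comp f) -(PhiC v); apply/esym/cP; last first.
  rewrite -(map_cone lI (fun i => PhiF i v)) -vE.
  by exists (size (cone j I F (nseq (j + n) false))); apply: level_map lJ.
exists (map_state (cone j I F) I1), (cone j I F t), (map_state (cone j I F) I2).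
split; rewrite ?size_map //.
have [m g] := strong_fork_grow b sg (level_live_at lJ).
apply: (completes_grow g); apply: strong_completes cJ => //.
exact: live_at_move (level_live_at lJ).
Qed.

(** Induction on the code. The fusion runs over the levels; a level has only finitely many states,
    and they are treated one after another. *)
Theorem milliken sigma : exists2 f, strong f &
  forall j I, level j I -> homogeneous f I sigma.
Proof.
elim: sigma => [|[b p] sigma [f1 sf1 H1]].
  exists (fun s => s); first exact: strong_id.
  move=> j I _ D D' c c'; congr chi; congr map.
  suff nilE E : completes I [::] E -> E = map snd I by rewrite (nilE _ c) (nilE _ c').
  move=> cE; apply: completes_nilE => //.
  move: cE; move Es: [::] => s cE; elim: cE Es => // n J K s' E' JK _ IH /IH.
  elim: J K JK {IH} => [|[a x] J IH] [|[a' y] K] //= /andP[/andP[/= /eqP<- _]].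
  by move=> /IH{}IH /andP[-> /IH].
pose P j f := forall I, level j I -> homogeneous (f1 \o f) I ((b, p) :: sigma).
have [|j f g _ PJ Eg I lI|f sf fP] := @fusion P.
- move=> j f sf; have [L LP] := level_enum j.
  have Hf := homogeneous_comp sf H1.
  suff [g gj gL] : exists2 g, fixes_below j g & forall I, I \in L -> level j I ->
      homogeneous ((f1 \o f) \o g) I ((b, p) :: sigma).
    by exists g => // I lI; apply: gL => //; apply: LP.
  elim: L {LP} => [|I L [g gj gL]].
    by exists (fun s => s) => //; split => //; exact: strong_id.
  have [lI|lI] := boolP (level j I); last first.
    exists g => // I'; rewrite inE => /orP[/eqP->|]; last exact: gL.
    by rewrite (negbTE lI).
  have [h hj hI] := homogeneous_cone b p (homogeneous_comp gj.1 Hf) lI.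
  exists (g \o h).
    split; first exact: strong_comp gj.1 hj.1.
    by move=> s sj; rewrite /= hj.2 // gj.2.
  move=> I'; rewrite inE => /orP[/eqP->//|I'L lI'].
  exact: (homogeneous_fix hj lI' (gL _ I'L lI')).
- exact: (homogeneous_fix Eg lI (PJ _ lI)).
by exists (f1 \o f); [exact: strong_comp|move=> j I; apply: fP].
Qed.

End Milliken.

Corollary milliken_seq (C : finType) (chi : seq node -> C) (L : seq (seq move)) :
  exists2 f, strong f & forall sigma, sigma \in L ->
    homogeneous chi f [:: (true, [::])] sigma.
Proof.
elim: L => [|sigma L [f sf fL]]; first by exists (fun s => s) => //; exact: strong_id.
have [h sh hP] := milliken (chi \o map f) sigma.
exists (f \o h); first exact: strong_comp.
move=> s; rewrite inE => /orP[/eqP->|sL]; last first.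
  by apply: (@homogeneous_fix _ _ _ _ 0) => //; apply: fL.
move=> D D' c c'; rewrite (map_comp f h D) (map_comp f h D').
exact: (hP 0 [:: (true, [::])]).
Qed.

(** * Codes and the derivatives of the tangent *)

Definition move_flags (m : move) (l : seq bool) : seq bool :=
  take m.2 l ++ (if m.1 then [:: true; true] else [:: false]) ++ drop m.2.+1 l.

Fixpoint codes (n : nat) (l : seq bool) : seq (seq move) :=
  if n is n'.+1 then
    flatten [seq [seq (true, p) :: s | s <- codes n' (move_flags (true, p) l)] ++
                 [seq (false, p) :: s | s <- codes n' (move_flags (false, p) l)] |
      p <- [seq p <- seq.iota 0 (size l) | nth false l p]]
  else if all negb l then [:: [::]] else [::].

(** The argument [k] is the number of living branches; the truncation of [k.-1] at 0 is masked by
    the factor [k]. *)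
Fixpoint code_count (n k : nat) : nat :=
  if n is n'.+1 then k * (code_count n' k.-1 + code_count n' k.+1)
  else (k == 0).

Lemma codesSE n l m s : (m :: s \in codes n.+1 l) =
  [&& m.2 < size l, nth false l m.2 & s \in codes n (move_flags m l)].
Proof.
apply/flattenP/and3P => [[_ /mapP[p + ->]]|].
  rewrite mem_filter mem_iota add0n /= => /andP[lp pl].
  by rewrite mem_cat => /orP[] /mapP[s' sc [-> ->]].
case: m => b p /= [pl lp sc].
exists ([seq (true, p) :: s | s <- codes n (move_flags (true, p) l)] ++
        [seq (false, p) :: s | s <- codes n (move_flags (false, p) l)]).
  by apply/mapP; exists p; rewrite // mem_filter mem_iota lp pl.
by rewrite mem_cat; apply/orP; case: b sc => sc; [left|right]; apply/mapP; exists s.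
Qed.

Lemma uniq_codes n l : uniq (codes n l).
Proof.
elim: n l => [|n IH] l /=; first by case: ifP.
set ps := (X in map _ X).
have : uniq ps by rewrite filter_uniq // iota_uniq.
elim: ps => //= p ps IHp /andP[pps /IHp u]; rewrite !cat_uniq u andbT.
rewrite !map_inj_uniq ?IH //=; try by move=> s s' [].
apply/andP; split.
  by rewrite andbT; apply/hasPn => _ /mapP[s _ ->]; apply/mapP => -[].
apply/hasPn => z /flattenP[ss /mapP[p' p'ps ->] sp']; apply/negP => sp.
have : p = p' by move: sp' sp; rewrite !mem_cat => /orP[] /mapP[s _ ->] /orP[] /mapP[s' _ []].
by move=> E; rewrite E p'ps in pps.
Qed.

Lemma grow_flags n (I J : state) : all2 (grow n) I J -> map fst I = map fst J.
Proof. by elim: I J => [|x I IH] [|y J] //= /andP[/andP[/eqP-> _] /IH->]. Qed.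

Lemma map_fst_move b t I1 I2 :
  map fst (pass0 I1 ++ fork b t ++ pass0 I2) =
  move_flags (b, size I1) (map fst (I1 ++ (true, t) :: I2)).
Proof.
have flag0 K : map fst (pass0 K) = map fst K by rewrite -map_comp.
rewrite /move_flags !map_cat !flag0 /= take_size_cat ?size_map //.
rewrite -cat_rcons drop_size_cat ?size_rcons ?size_map //.
by case: b.
Qed.

Lemma completes_codes I sigma D : completes I sigma D ->
  sigma \in codes (size sigma) (map fst I).
Proof.
elim=> {I sigma D} [I dI|n I J s D IJ _|b I1 I2 t s D _ IH] /=.
- by rewrite all_map dI inE.
- by rewrite (grow_flags IJ).
- rewrite map_fst_move in IH; rewrite -[flatten _]/(codes (size s).+1 _) codesSE IH andbT.
  by rewrite size_map size_cat /= addnS ltnS leq_addr map_cat nth_cat size_map ltnn subnn.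
Qed.

(** There are [size D - size I] splits, and each living branch, old or new, is ended once. For the
    root this gives [2 n - 1] moves. *)
Lemma completes_size I sigma D : completes I sigma D ->
  size sigma + 2 * size I = count fst I + 2 * size D.
Proof.
elim=> {I sigma D} [I dI|n I J s D IJ _|b I1 I2 t s D _] /=.
- have : ~~ has fst I by rewrite -all_predC.
  by rewrite has_count -eqn0Ngt size_map => /eqP->.
- suff [-> ->] : size I = size J /\ count fst I = count fst J by [].
  elim: I J IJ => [|x I IH] [|y J] //= /andP[/andP[/eqP-> _] /IH[-> ->]] //.
- have count0 K : count fst (pass0 K) = count fst K by rewrite count_map; apply: eq_count.
  rewrite !size_cat !count_cat !count0 !size_map /=.
  by case: b => /=; lia.
Qed.

Lemma size_codes n l : size (codes n l) = code_count n (count idfun l).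
Proof.
elim: n l => [|n IH] l.
  rewrite /codes /code_count; have -> : all negb l = (count idfun l == 0).
    by rewrite eqn0Ngt -has_count -all_predC.
  by rewrite /=; case: ifP.
rewrite /= size_flatten /shape -map_comp.
set K := count idfun l.
rewrite (eq_in_map _ (fun=> code_count n K.-1 + code_count n K.+1) _).1.
  have sumc (s : seq nat) c : sumn [seq c | _ <- s] = size s * c.
    by elim: s => //= _ s ->; rewrite mulSn.
  rewrite sumc; congr (_ * _); rewrite size_filter.
  by rewrite -[RHS]/(count idfun l) -{3}(mkseq_nth false l) count_map.
move=> p; rewrite mem_filter mem_iota add0n /= => /andP[lp pl].
rewrite size_cat !size_map !IH addnC.
have KE : K = count idfun (take p l) + (1 + count idfun (drop p.+1 l)).
  by rewrite /K -{1}(cat_take_drop p l) (drop_nth false) // count_cat /= lp.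
by congr (code_count n _ + code_count n _); rewrite /move_flags !count_cat /= KE; lia.
Qed.

Section TangentDerivatives.
Local Open Scope R_scope.

Fixpoint tan_pow_deriv (m k : nat) (x : R) : R :=
  if m is m'.+1 then INR k * (tan_pow_deriv m' k.-1 x + tan_pow_deriv m' k.+1 x)
  else tan x ^ k.

Lemma is_derive_tan_pow m k x : cos x <> 0 ->
  is_derive (tan_pow_deriv m k) x (tan_pow_deriv m.+1 k x).
Proof.
move=> cx; elim: m k => [|m IH] k.
  case: k => [|k].
    by rewrite /tan_pow_deriv /= Rmult_0_l; apply: is_derive_const.
  have := is_derive_pow tan k.+1 x _ (is_derive_tan x cx).
  suff -> : INR k.+1 * (tan x ^ 2 + 1) * tan x ^ Nat.pred k.+1 = tan_pow_deriv 1 k.+1 x by [].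
  by rewrite /tan_pow_deriv -!pred_Sn /=; ring.
rewrite -/(tan_pow_deriv m.+2 k x).
apply: (is_derive_scal (fun y => tan_pow_deriv m k.-1 y + tan_pow_deriv m k.+1 y)).
exact: (is_derive_plus (tan_pow_deriv m k.-1) (tan_pow_deriv m k.+1)).
Qed.

Lemma Derive_n_tan_pow m x : cos x <> 0 ->
  Derive_n tan m x = tan_pow_deriv m 1 x.
Proof.
elim: m x => [|m IH] x cx; first by rewrite /= Rmult_1_r.
rewrite -(is_derive_unique _ _ _ (is_derive_tan_pow m 1 cx)) /=.
apply: Derive_ext_loc.
have L : locally x (fun y => cos y <> 0) :=
  continuous_cos x (fun y => y <> 0) (open_neq 0 _ cx).
by apply: (filter_imp _ _ _ L) => y; apply: IH.
Qed.

Lemma tan_pow_deriv0 m k : tan_pow_deriv m k 0 = INR (code_count m k).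
Proof.
elim: m k => [|m IH] k; last by rewrite /= !IH -plus_INR -mult_INR.
by case: k => [|k] /=; rewrite ?tan_0; ring.
Qed.

Lemma Derive_n_tan0 m : Derive_n tan m 0 = INR (code_count m 1).
Proof. by rewrite Derive_n_tan_pow ?tan_pow_deriv0 // cos_0; lra. Qed.

End TangentDerivatives.

(** * The code of an antichain *)

(* Lexicographic order between incomparable nodes; it is false on comparable ones. *)
Fixpoint nlt (s t : node) : bool :=
  match s, t with
  | a :: s', b :: t' => if a == b then nlt s' t' else b
  | _, _ => false
  end.

Lemma nltP s t :
  reflect (exists w, prefix (rcons w false) s && prefix (rcons w true) t) (nlt s t).
Proof.
apply: (iffP idP) => [|[w /andP[/prefixP[s1 ->] /prefixP[t1 ->]]]]; last first.
  by rewrite !cat_rcons; elim: w => //= a w IH; rewrite eqxx.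
elim: s t => [|a s IH] [|b t] //=; case: eqP => [<- /IH[w /andP[ws wt]]|].
  by exists (a :: w); rewrite /= eqxx ws wt.
by case: a; case: b => //= _ _; exists [::]; rewrite /= ?prefix0s.
Qed.

Lemma nlt_catl w s t : nlt (w ++ s) (w ++ t) = nlt s t.
Proof. by elim: w => //= a w ->; rewrite eqxx. Qed.

Lemma nlt_prefix s t s' t' : prefix s s' -> prefix t t' -> nlt s t -> nlt s' t'.
Proof.
move=> ss' tt' /nltP[w /andP[ws wt]]; apply/nltP; exists w.
by rewrite (prefix_trans ws) // (prefix_trans wt).
Qed.

Lemma nltNprefix s t : nlt s t -> ~~ prefix s t.
Proof.
move=> st; apply/negP => /prefixP[w tw]; move: st; rewrite tw.
by elim: s {tw} => //= a s IH; rewrite eqxx.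
Qed.

Lemma nlt_asym s t : nlt s t -> ~~ nlt t s.
Proof.
elim: s t => [|a s IH] [|b t] //=; rewrite [b == a]eq_sym.
by case: eqP => [_ /IH|] //; case: a; case: b.
Qed.

Lemma nltNprefix_sym s t : nlt s t -> ~~ prefix t s.
Proof.
move=> st; apply/negP => /prefixP[w sw]; move: st; rewrite sw.
by elim: t {sw} => [|a t IH] /=; [case: w | rewrite eqxx].
Qed.

Lemma nltxx s : nlt s s = false.
Proof. by elim: s => //= a s ->; rewrite eqxx. Qed.

Lemma nlt_same_size s t : size s = size t -> s != t -> nlt s t || nlt t s.
Proof.
elim: s t => [|a s IH] [|b t] //= [st]; rewrite eqseq_cons [b == a]eq_sym.
by case: eqP => [_ /(IH _ st)|] //; case: a; case: b.
Qed.

Lemma strong_nlt f s t : strong f -> nlt s t -> nlt (f s) (f t).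
Proof.
move=> sf /nltP[w /andP[ws wt]]; apply/nltP; exists (f w).
rewrite (prefix_trans (sf.1 w false) (strong_prefix sf ws)).
by rewrite (prefix_trans (sf.1 w true) (strong_prefix sf wt)).
Qed.

Lemma nlt_letter l s t : take l s = take l t -> l < size s -> l < size t ->
  nlt s t -> nth false s l -> nth false t l.
Proof.
elim: l s t => [|l IH] [|a s] [|b t] //=; first by case: a; case: b.
by move=> [<-]; rewrite eqxx; apply: IH.
Qed.

(* The blocks of [G] are the antichain elements which continue the branches of [I]. *)
Definition groups (I : state) (G : seq (seq node)) : bool :=
  all2 (fun x g => (g != [::]) &&
    (if x.1 then all (prefix x.2) g else g == [:: x.2])) I G.

Lemma groups_cat I1 I2 G : groups (I1 ++ I2) G ->
  exists G1 G2, [/\ G = G1 ++ G2, groups I1 G1 & groups I2 G2].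
Proof.
rewrite /groups; elim: I1 G => [|x I1 IH] [|g G] //=.
- by case: I2 => // _; exists [::], [::].
- by move=> H; exists [::], (g :: G).
move=> /andP[xg /IH[G1 [G2 [-> H1 H2]]]].
by exists (g :: G1), G2; rewrite /= xg.
Qed.

Lemma cat_groups I1 I2 G1 G2 : groups I1 G1 -> groups I2 G2 ->
  groups (I1 ++ I2) (G1 ++ G2).
Proof. exact: cat_all2. Qed.

Lemma completes_groups I sigma D : completes I sigma D ->
  exists2 G, flatten G = D & groups I G.
Proof.
elim=> {I sigma D} [I dI|n I J s D IJ _ [G <- JG]|b I1 I2 t s D _ [G <- JG]].
- exists [seq [:: x.2] | x <- I]; first by elim: I dI => //= x I IH /andP[_ /IH->].
  by rewrite /groups; elim: I dI => //= -[[] x] I IH //= /IH->; rewrite eqxx.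
- exists G => //; move: IJ JG; rewrite /groups.
  elim: I J G => [|[a x] I IH] [|[a' y] J] [|g G] //= /andP[/andP[/= /eqP<- +]].
  move=> xy /(IH _ G){}IH /andP[/andP[-> +] /IH->]; rewrite andbT /=.
  case: a xy => [/andP[xy _]|/eqP-> //].
  by apply: sub_all => z; apply: prefix_trans.
- have pass0_groups K G' : groups (pass0 K) G' -> groups K G'.
    rewrite /groups; elim: K G' => [|[a x] K IH] [|g G'] //= /andP[/andP[-> +] /IH->].
    rewrite andbT; case: a => //; apply: sub_all => z; apply: prefix_trans.
    exact: prefix_rcons.
  move/groups_cat: JG => [G1 [G' [-> /pass0_groups H1]]].
  move/groups_cat => [Gf [G2 [-> Hf /pass0_groups H2]]].
  exists (G1 ++ flatten Gf :: G2); first by rewrite !flatten_cat.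
  apply: cat_groups => //=; rewrite /groups /= -/(groups I2 G2) H2 andbT.
  case: b Hf; rewrite /groups /fork; case: Gf => [|g0 [|g1 [|g2 Gf]]] //=;
    rewrite ?andbF ?andbT ?cats0 //.
  + case/andP => /andP[g00 p0] /andP[_ p1].
    apply/andP; split; first by case: g0 g00 {p0}.
    rewrite all_cat; apply/andP; split; [move: p0|move: p1];
      by apply: sub_all => z; apply/prefix_trans/prefix_rcons.
  + by case/andP => _ /eqP->; rewrite /= prefix_refl.
Qed.

Definition cut (l : nat) (y : node) : bool * node :=
  if size y < l then (false, y) else (true, take l y).

Lemma cut_groups l I G : level l I -> groups I G ->
  I = undup (map (cut l) (flatten G)).
Proof.
rewrite /groups => /andP[]; elim: I G => [|[a x] I IH] [|g G] //=.
move=> /andP[ax aI] /andP[xI uI] /andP[/andP[g0 xg] IG].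
have cg : map (cut l) g = nseq (size g) (a, x).
  case: a ax xg {xI} => /= [/eqP xl|xl /eqP->]; last by rewrite /= /cut xl.
  elim: g {g0} => //= y g IHg /andP[/prefixP[w ->] /IHg->].
  by rewrite /cut size_cat xl ltnNge leq_addr /= take_size_cat.
rewrite map_cat cg; case: g g0 {xg cg} => //= _ g _.
elim: g => [|_ g IHg] /=.
  by rewrite -mem_undup -(IH G) // (negbTE xI).
by rewrite inE eqxx.
Qed.

Lemma count_move_flags b p l : nth false l p ->
  count idfun (move_flags (b, p) l) + ~~ b = count idfun l + b.
Proof.
move=> lp; have [pl|pl] := ltnP p (size l); last by rewrite nth_default in lp.
rewrite /move_flags !count_cat /=.
have -> : count idfun l = count idfun (take p l) + (1 + count idfun (drop p.+1 l)).
  by rewrite -{1}(cat_take_drop p l) (drop_nth false) // count_cat /= lp.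
by case: b => /=; lia.
Qed.

Lemma completes_level I j sigma D : level j I -> completes I sigma D ->
  I = undup (map (cut j) D).
Proof. by move=> lI /completes_groups[G <-]; apply: cut_groups. Qed.

Lemma grow_take n m I J : all2 (grow (n + m)) I J ->
  exists2 K, all2 (grow n) I K & all2 (grow m) K J.
Proof.
elim: I J => [|[a x] I IH] [|[a' y] J] //=; first by exists [::].
move=> /andP[/andP[/= /eqP<- +] /IH[K IK KJ]].
case: a => [/andP[/prefixP[w ->]]|/eqP<-]; last first.
  by exists ((false, x) :: K); rewrite /= /grow /= ?eqxx ?IK.
rewrite size_cat eqn_add2l => /eqP sw.
exists ((true, x ++ take n w) :: K); rewrite /grow /= ?IK ?KJ andbT size_cat.
  by rewrite prefix_prefix size_takel ?eqxx // sw leq_addr.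
rewrite -{2}(cat_take_drop n w) catA prefix_prefix !size_cat sw.
by rewrite size_takel ?sw ?leq_addr // addnA eqxx.
Qed.

(** Living entries of [pass0] end in [false], so the right child is the only living entry that ends
    in [true]. Flags would not suffice: splitting either of two adjacent living branches gives the
    same flags. *)
Lemma split_position I1 I1' I2 I2' t t' :
    pass0 I1 ++ fork true t ++ pass0 I2 = pass0 I1' ++ fork true t' ++ pass0 I2' ->
  size I1' <= size I1.
Proof.
move=> E; rewrite leqNgt; apply/negP => lt; pose d : bool * node := (false, [::]).
have sz K : size (pass0 K) = size K by rewrite size_map.
have {E} := congr1 (fun K => nth d K (size I1).+1) E.
rewrite nth_cat sz ltnNge leqnSn subSnn /=.
have -> : pass0 I1' ++ fork true t' ++ pass0 I2' =
    pass0 (rcons I1' (true, t')) ++ (true, rcons t' true) :: pass0 I2'.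
  by rewrite /pass0 map_rcons cat_rcons.
rewrite nth_cat sz size_rcons ltnS lt (nth_map d) ?size_rcons //.
by case: (nth d _ _) => -[] x //= [] /rcons_inj [].
Qed.

Lemma split_flag_position p p' l : nth false l p -> nth false l p' ->
  move_flags (false, p) l = move_flags (false, p') l -> p = p'.
Proof.
have flags_nth q r : nth false l q ->
    nth false (move_flags (false, q) l) r = (r != q) && nth false l r.
  move=> lq; have ql : q < size l.
    by rewrite ltnNge; apply: contraL lq => /(nth_default false)->.
  rewrite /move_flags /= nth_cat size_takel; last exact: ltnW.
  have [rq|qr|->] := ltngtP r q.
  - by rewrite nth_take.
  - have [k ->] : exists k, r = q + k.+1 by exists (r - q.+1); lia.
    by rewrite addKn /= nth_drop addSnnS.
  - by rewrite subnn.
move=> lp lp' E; apply/eqP; have := congr1 (fun K => nth false K p) E.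
by rewrite !flags_nth // eqxx lp andbT; case: eqP.
Qed.

(** At equal levels both derivations show the same state, by [completes_level]. The number of living
    branches tells when the next move occurs and whether it splits or ends a branch. *)
Theorem completes_inj I j sigma sigma' D : level j I ->
  completes I sigma D -> completes I sigma' D -> sigma = sigma'.
Proof.
have flag_eq (x y : nat) (c c' : bool) : x + ~~ c = y + c -> x + ~~ c' = y + c' -> c = c'.
  by case: c; case: c' => /=; lia.
have nil_alive J s E : completes J s E -> s = [::] -> all negb (map fst J).
  elim=> {J s E} // [J dJ _|n J K s E JK _ IH /IH]; first by rewrite all_map.
  by rewrite (grow_flags JK).
have cons_alive J m s E : completes J (m :: s) E -> ~~ all negb (map fst J).
  case: m => b p /completes_moveE[n [J1 [t [J2 [JK _ _]]]]].
  by rewrite (grow_flags JK) map_cat all_cat /= andbF.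
(* A derivation that waited longer would still have the old number of living branches at level
   [i + n + 1], where the other has already changed it. *)
have later n n' b J I1 t I2 i s E : level i J ->
    all2 (grow n) J (I1 ++ (true, t) :: I2) ->
    completes (pass0 I1 ++ fork b t ++ pass0 I2) s E ->
    forall K s', all2 (grow n') J K -> completes K s' E -> n' <= n.
  move=> lJ JI c K s' JK c'; rewrite leqNgt; apply/negP => nn'.
  rewrite -(subnKC nn') in JK; have [J2 JJ2 J2K] := grow_take JK.
  have := completes_level (level_move b (level_grow lJ JI)) c.
  have := completes_level (level_grow lJ JJ2) (completes_grow J2K c').
  rewrite addnS => <- F; have := congr1 (fun K => count idfun (map fst K)) F.
  rewrite map_fst_move -(grow_flags JJ2) (grow_flags JI).
  have := @count_move_flags b (size I1) (map fst (I1 ++ (true, t) :: I2)).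
  rewrite map_cat /= nth_cat size_map ltnn subnn /= => /(_ isT).
  by case: b {c F} => /=; lia.
elim: sigma I j sigma' => [|[b p] s IH] I j [|[b' p'] s'] lI c c' //.
- by have := cons_alive _ _ _ _ c'; rewrite (nil_alive _ _ _ c).
- by have := cons_alive _ _ _ _ c; rewrite (nil_alive _ _ _ c').
have [n [I1 [t [I2 [II -> c1]]]]] := completes_moveE c.
have [n' [I1' [t' [I2' [II' -> c1']]]]] := completes_moveE c'.
have cc := completes_move c1; have cc' := completes_move c1'.
have {c c'} nn' : n = n'.
  apply/eqP; rewrite eqn_leq (later _ _ _ _ _ _ _ _ _ _ lI II' c1' _ _ II cc).
  by rewrite (later _ _ _ _ _ _ _ _ _ _ lI II c1 _ _ II' cc').
rewrite -{}nn' in II'.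
have lJ := level_grow lI II; have lJ' := level_grow lI II'.
have JJ : I1 ++ (true, t) :: I2 = I1' ++ (true, t') :: I2'.
  by rewrite (completes_level lJ cc) (completes_level lJ' cc').
have lK := level_move b lJ; have lK' := level_move b' lJ'.
have KK : pass0 I1 ++ fork b t ++ pass0 I2 = pass0 I1' ++ fork b' t' ++ pass0 I2'.
  by rewrite (completes_level lK c1) (completes_level lK' c1').
have FF := congr1 (map fst) KK; rewrite !map_fst_move -JJ in FF.
set l := map fst (I1 ++ (true, t) :: I2) in FF.
have l1 : nth false l (size I1) by rewrite /l map_cat nth_cat size_map ltnn subnn.
have l1' : nth false l (size I1') by rewrite /l JJ map_cat nth_cat size_map ltnn subnn.
have bb : b = b'.
  by apply: (flag_eq _ _ _ _ (count_move_flags b l1)); rewrite FF; apply: count_move_flags.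
rewrite -{}bb in KK FF lK' c1' *; congr ((_, _) :: _).
  case: b {c1 c1' lK lK' cc cc'} KK FF => KK FF.
    apply/eqP; rewrite eqn_leq (split_position KK).
    by rewrite (split_position (esym KK)).
  exact: (split_flag_position l1 l1' FF).
by apply: (IH _ _ _ lK c1); rewrite KK.
Qed.

Lemma prefix_sorted (s t : seq node) : all2 (@prefix bool) s t ->
  pairwise nlt s -> pairwise nlt t.
Proof.
elim: s t => [|x s IH] [|y t] //= /andP[xy st] /andP[xs /(IH _ st)->].
rewrite andbT; move: xs st; elim: s t {IH} => [|z s IH] [|w t] //=.
move=> /andP[xz /IH{}IH] /andP[zw /IH->]; rewrite andbT.
exact: nlt_prefix xz.
Qed.

Lemma grow_pass0 I : all2 (grow 1) I (pass0 I).
Proof.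
elim: I => //= -[[] x] I -> /=; rewrite andbT /grow /= ?eqxx //.
by rewrite prefix_rcons size_rcons addn1 eqxx.
Qed.

Lemma completes_sorted I sigma D : completes I sigma D ->
  pairwise nlt (map snd I) -> pairwise nlt D.
Proof.
elim=> {I sigma D} [//|n I J s D IJ _ IH sI|b I1 I2 t s D _ IH sI]; apply: IH.
  apply: prefix_sorted sI.
  elim: I J IJ => [|x I IH] [|y J] //= /andP[/andP[_ xy] /IH->]; rewrite andbT.
  by case: x.1 xy => [/andP[]|/eqP->] //; rewrite prefix_refl.
have pre0 K : all2 (@prefix bool) (map snd K) (map snd (pass0 K)).
  by elim: K => //= -[[] x] K -> /=; rewrite ?prefix_rcons ?prefix_refl.
have sorted_at u : prefix t u -> pairwise nlt (map snd (pass0 I1) ++ u :: map snd (pass0 I2)).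
  move=> tu; apply: prefix_sorted sI; rewrite map_cat /=.
  elim: I1 => [|x I1 IH] /=; first by rewrite tu pre0.
  by rewrite IH; case: x => [[] x]; rewrite /= ?prefix_rcons ?prefix_refl.
rewrite !map_cat; case: b => /=; last by apply: sorted_at; rewrite prefix_refl.
move: (sorted_at _ (prefix_rcons t false)) (sorted_at _ (prefix_rcons t true)).
rewrite !pairwise_cat !allrel_consr /= => /and3P[/andP[-> ->] -> /andP[-> _]].
move=> /and3P[/andP[-> _] _ /andP[-> ->]]; rewrite !andbT /=.
by rewrite -!cats1 nlt_catl.
Qed.

Lemma prefix_letter s z a : prefix s z -> size s < size z ->
  nth false z (size s) = a -> prefix (rcons s a) z.
Proof.
move=> /prefixP[w ->]; rewrite size_cat -{1}[size s]addn0 ltn_add2l.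
rewrite nth_cat ltnn subnn; case: w => // b w _ /= <-.
by rewrite -cat_rcons prefix_prefix.
Qed.

Lemma pass0_groups l (K : state) G : (forall x, x \in K -> x.1 -> size x.2 = l) -> groups K G ->
    {in flatten G, forall z, l <= size z -> l < size z /\ nth false z l = false} ->
  groups (pass0 K) G.
Proof.
elim: K G => [|[a x] K IH] [|g G] //= xl.
rewrite /groups /= => /andP[/andP[-> xg] KG] H.
rewrite -/(groups _ _) IH ?andbT //=; first last.
- by move=> z zG; apply: H; rewrite mem_cat zG orbT.
- by move=> y yK; apply: xl; rewrite inE yK orbT.
case: a xg xl => //= /allP xg /(_ (true, x) (mem_head _ _) isT) /= xl.
apply/allP => z zg; have xz := xg _ zg.
have zG : z \in g ++ flatten G by rewrite mem_cat zg.
have lz : l <= size z by rewrite -xl size_prefix.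
by have [lz' z0] := H z zG lz; apply: prefix_letter; rewrite ?xl.
Qed.

Lemma groups_split y I G : groups I G -> y \in flatten G ->
  exists I1 x I2 G1 g G2, [/\ I = I1 ++ x :: I2, G = G1 ++ g :: G2,
    groups I1 G1, groups I2 G2 & y \in g /\ groups [:: x] [:: g]].
Proof.
elim: I G => [|x I IH] [|g G] //= /andP[xg IG]; rewrite mem_cat.
have [yg _|_ /= yG] := boolP (y \in g).
  by exists [::], x, I, [::], g, G; split => //; split => //; rewrite /groups /= xg.
have [I1 [x' [I2 [G1 [g' [G2 [-> -> H1 H2 H3]]]]]]] := IH _ IG yG.
by exists (x :: I1), x', I2, (g :: G1), g', G2; split => //; rewrite /groups /= xg.
Qed.

(** The last three hypotheses leave one event per level: no two leaves share a level, only one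
    branch takes [true], and where a leaf ends all longer words take [false]. The code is read level
    by level. *)
Lemma completes_antichain (Y : seq node) : Y != [::] -> pairwise nlt Y ->
    {in Y &, forall y z, size y = size z -> y = z} ->
    {in Y &, forall y z l, l < size y -> l < size z -> nth false y l ->
      nth false z l -> take l y = take l z} ->
    {in Y &, forall y z, size y < size z -> nth false z (size y) = false} ->
  exists sigma, completes [:: (true, [::])] sigma Y.
Proof.
case: Y => // y0 Y _ sY hA hB hC.
have [L YL] : exists L, {in y0 :: Y, forall y, size y < L}.
  exists (\max_(y <- y0 :: Y) size y).+1 => y yY.
  by rewrite ltnS; apply: (@leq_bigmax_seq _ (y0 :: Y) xpredT size).
suff cover k l I G : level l I -> groups I G -> flatten G = y0 :: Y -> L <= l + k ->
    exists sigma, completes I sigma (y0 :: Y).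
  apply: (cover L 0 _ [:: y0 :: Y]) => //; last by rewrite /= cats0.
  by rewrite /groups /= andbT prefix0s; apply/allP => z _; rewrite prefix0s.
elim: k l I G => [|k IH] l I G lI IG GY; have [/allP aI uI] := andP lI.
  rewrite addn0 => Ll; exists [::].
  have dead : all (fun x => ~~ x.1) I.
    apply/allP => x xI; apply/negP => x1.
    have [I1 [I2 EI]] : exists I1 I2, I = I1 ++ x :: I2.
      by case/splitPr: xI => I1 I2; exists I1, I2.
    have := aI x xI; rewrite x1 => /eqP sx.
    move: IG; rewrite EI => /groups_cat[G1 [[|g G2] [EG _ //]]].
    rewrite /groups /= x1 => /andP[/andP[g0 gx] _].
    case: g g0 gx EG => //= z g _ /andP[xz _] EG.
    have zY : z \in y0 :: Y by rewrite -GY EG flatten_cat /= !mem_cat inE eqxx orbT.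
    have := size_prefix xz; rewrite sx leqNgt (leq_trans (YL _ zY)) //.
  suff -> : y0 :: Y = map snd I by apply: completes_done.
  rewrite -GY; move: dead IG; elim: I G {aI uI lI GY} => [|x I IHI] [|g G] //=.
  move=> /andP[/negbTE x1 dI]; rewrite /groups /= x1 => /andP[/andP[_ /eqP->] /IHI->] //.
rewrite addnS -addSn => Ll.
have sizeI : forall x, x \in I -> x.1 -> size x.2 = l.
  by move=> x /aI; case: x.1 => // /eqP.
(* A leaf at this level is alone in its block, and the other branches pass with [false]. *)
have [/hasP[y yY /eqP yl]|noleaf] := boolP (has (fun y => size y == l) (y0 :: Y)).
  have yG : y \in flatten G by rewrite GY.
  have [I1 [x [I2 [G1 [g [G2 [EI EG H1 H2 [yg xg]]]]]]]] := groups_split IG yG.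
  have xI : x \in I by rewrite EI mem_cat inE eqxx orbT.
  have Ex : x = (true, y).
    move: xg (aI x xI); rewrite /groups; case: (x) => -[] x2 /=; rewrite !andbT => /andP[_].
      move=> /allP/(_ _ yg)/prefixP[w Ey] /eqP sx; congr (_, _).
      by move: yl; rewrite Ey size_cat sx -{2}[l]addn0 => /addnI/size0nil->; rewrite cats0.
    by move=> /eqP gE; move: yg; rewrite gE inE => /eqP <-; rewrite yl ltnn.
  have pairG : pairwise nlt (flatten G1 ++ g ++ flatten G2).
    by rewrite -[_ ++ _ ++ _]/(_ ++ flatten (g :: G2)) -flatten_cat -EG GY.
  have Eg : g = [:: y].
    move: pairG xg yg; rewrite Ex /groups /= !andbT !pairwise_cat.
    move=> /and3P[_ _ /and3P[_ pg _]] /andP[_].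
    case: g pg {EG} => // z g /= /andP[zg _] /andP[yz yg]; rewrite inE => /predU1P[zy|yg'].
      case: g zg yg => [|w g]; rewrite ?zy //= => /andP[zw _] /andP[yw _].
      by move: (nltNprefix zw); rewrite yw.
    by move: (nltNprefix_sym (allP zg _ yg')); rewrite yz.
  have ylt z : z \in flatten G1 \/ z \in flatten G2 -> z \in y0 :: Y /\ z != y.
    move=> zG; split.
      by rewrite -GY EG flatten_cat /= !mem_cat; case: zG => ->; rewrite ?orbT.
    apply: contraTneq pairG => zy; rewrite Eg -zy !pairwise_cat /=; case: zG => zG.
      by rewrite allrel_consr; case: allP => //= /(_ z zG); rewrite nltxx.
    by rewrite allrel_consl andbC; case: allP => [/(_ z zG)|]; rewrite ?nltxx ?andbF.
  have let0 z : z \in flatten G1 \/ z \in flatten G2 -> l <= size z ->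
      l < size z /\ nth false z l = false.
    move=> /ylt[zY zy] lz; have lz' : l < size z.
      rewrite ltn_neqAle lz andbT; apply: contra zy => /eqP lz'; apply/eqP/hA => //.
      by rewrite yl.
    by split => //; rewrite -yl hC // yl.
  have [||sigma c] := IH l.+1 (pass0 I1 ++ fork false y ++ pass0 I2) G _ _ GY Ll.
  - by apply: level_move; rewrite -Ex -EI.
  - rewrite EG; apply: cat_groups.
      apply: (pass0_groups (l := l)) => //.
        by move=> z zI; apply: sizeI; rewrite EI mem_cat zI.
      by move=> z zG; apply: let0; left.
    rewrite -cat1s; apply: cat_groups; first by rewrite /groups /= Eg eqxx.
    apply: (pass0_groups (l := l)) => //.
      by move=> z zI; apply: sizeI; rewrite EI mem_cat inE zI !orbT.
    by move=> z zG; apply: let0; right.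
  exists ((false, size I1) :: sigma); rewrite EI Ex; exact: completes_move.
have big z : z \in y0 :: Y -> l <= size z -> l < size z.
  move=> zY; rewrite leq_eqVlt => /predU1P[lz|//]; exfalso.
  by move/hasPn: noleaf => /(_ z zY); rewrite -lz eqxx.
have [/hasP[z0 z0Y /andP[lz0 z0t]]|noone] :=
    boolP (has (fun z => (l < size z) && nth false z l) (y0 :: Y)); last first.
  have [||sigma c] := IH l.+1 (pass0 I) G _ _ GY Ll.
  - by rewrite -addn1; apply: level_grow (grow_pass0 I).
  - apply: (pass0_groups (l := l)) => // z; rewrite GY => zY /(big z zY) lz; split => //.
    by move/hasPn: noone => /(_ z zY); rewrite lz /= => /negbTE.
  by exists sigma; apply: completes_grow (grow_pass0 I) c.
have z0G : z0 \in flatten G by rewrite GY.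
have [I1 [x [I2 [G1 [g [G2 [EI EG H1 H2 [z0g xg]]]]]]]] := groups_split IG z0G.
have xI : x \in I by rewrite EI mem_cat inE eqxx orbT.
have Ex : x = (true, take l z0).
  move: xg (aI x xI); rewrite /groups; case: (x) => -[] x2 /=; rewrite !andbT => /andP[_].
    by move=> /allP/(_ _ z0g)/prefixP[w ->] /eqP <-; rewrite take_size_cat.
  by move=> /eqP gE; move: z0g lz0; rewrite gE inE => /eqP ->; case: ltngtP.
have sz0 : size (take l z0) = l by rewrite size_takel // ltnW.
have other z : z \in flatten G1 \/ z \in flatten G2 -> l <= size z ->
    l < size z /\ nth false z l = false.
  move=> zG; have zY : z \in y0 :: Y.
    by rewrite -GY EG flatten_cat /= !mem_cat; case: zG => ->; rewrite ?orbT.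
  move=> /(big z zY) lz; split => //; apply/negbTE/negP => zt.
  have Ez : take l z = take l z0 by apply: hB.
  have absurd K GK : groups K GK -> z \in flatten GK -> {subset K <= I} -> x \in K.
    move=> KG /(groups_split KG)[K1 [x' [K2 [_ [g' [_ [EK _ _ _ [zg' xg']]]]]]]] KI.
    have x'K : x' \in K by rewrite EK mem_cat inE eqxx orbT.
    suff -> : x = x' by [].
    rewrite Ex -Ez; move: xg' (aI x' (KI _ x'K)); rewrite /groups.
    case: (x') => -[] u /=; rewrite !andbT => /andP[_].
      by move=> /allP/(_ _ zg')/prefixP[w ->] /eqP <-; rewrite take_size_cat.
    by move=> /eqP gE; move: zg'; rewrite gE inE => /eqP <-; case: ltngtP lz.
  move: uI; rewrite EI cat_uniq /= => /and3P[_ /norP[xI1 _] /andP[xI2 _]].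
  case: zG => zG; [move: xI1|move: xI2].
    by rewrite (absurd _ _ H1 zG) // => u uI1; rewrite EI mem_cat uI1.
  by rewrite (absurd _ _ H2 zG) // => u uI2; rewrite EI mem_cat inE uI2 !orbT.
pose g0 := [seq z <- g | ~~ nth false z l]; pose g1 := [seq z <- g | nth false z l].
have gY z : z \in g -> z \in y0 :: Y.
  by move=> zg; rewrite -GY EG flatten_cat /= !mem_cat zg !orbT.
have gpre z : z \in g -> prefix (take l z0) z.
  by move: xg; rewrite /groups /= Ex andbT => /andP[_ /allP]; apply.
have gbig z : z \in g -> l < size z.
  by move=> zg; apply: big (gY _ zg) _; rewrite -sz0 size_prefix ?gpre.
have Eg : g = g0 ++ g1.
  have : pairwise nlt g.
    have : pairwise nlt (flatten G1 ++ g ++ flatten G2).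
      by rewrite -[_ ++ _ ++ _]/(_ ++ flatten (g :: G2)) -flatten_cat -EG GY.
    by rewrite !pairwise_cat => /and3P[_ _ /and3P[]].
  rewrite /g0 /g1; elim: (g) gpre gbig => //= z h IHh hpre hbig /andP[zh /IHh{}IHh].
  have IHg : h = [seq z <- h | ~~ nth false z l] ++ [seq z <- h | nth false z l].
    by apply: IHh => w wh; [apply: hpre|apply: hbig]; rewrite inE wh orbT.
  case zl: (nth false z l) => /=; last by rewrite -IHg.
  have ht : all (fun w => nth false w l) h.
    apply/allP => w wh; have wzh : w \in z :: h by rewrite inE wh orbT.
    apply: (nlt_letter _ _ _ (allP zh _ wh) zl); rewrite ?hbig ?mem_head //.
    have /prefixP[u1 ->] := hpre z (mem_head _ _).
    by have /prefixP[u2 ->] := hpre w wzh; rewrite !take_size_cat.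
  rewrite (all_filterP ht) (eq_in_filter (a2 := pred0)) ?filter_pred0 //.
  by move=> w /(allP ht) ->.
have g1N : g1 != [::].
  by apply/eqP => E1; have : z0 \in g1 by [rewrite mem_filter z0t z0g]; rewrite E1.
have pre_letter a h : {subset h <= g} -> {in h, forall z, nth false z l = a} ->
    all (prefix (rcons (take l z0) a)) h.
  move=> hg ha; apply/allP => z zh; have zg := hg z zh.
  by apply: prefix_letter; rewrite ?gpre // sz0 ?gbig ?ha.
have p1 : all (prefix (rcons (take l z0) true)) g1.
  by apply: pre_letter => z; rewrite mem_filter => /andP[].
have p0 : all (prefix (rcons (take l z0) false)) g0.
  by apply: pre_letter => z; rewrite mem_filter => /andP[// /negbTE].
have P1 : groups (pass0 I1) G1.
  apply: (pass0_groups (l := l)) => // z zI; last by apply: other; left.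
  by apply: sizeI; rewrite EI mem_cat zI.
have P2 : groups (pass0 I2) G2.
  apply: (pass0_groups (l := l)) => // z zI; last by apply: other; right.
  by apply: sizeI; rewrite EI mem_cat inE zI !orbT.
(* If nothing goes left, the branch merely takes the letter [true]: this is growth and not a
   split. *)
have [g00|g0N] := eqVneq g0 [::].
  have growJ : all2 (grow 1) I (pass0 I1 ++ (true, rcons (take l z0) true) :: pass0 I2).
    rewrite EI Ex; apply: cat_all2 (grow_pass0 I1) _ => /=; rewrite grow_pass0 andbT /grow /=.
    by rewrite prefix_rcons size_rcons addn1 eqxx.
  have [||sigma c] := IH l.+1 (pass0 I1 ++ (true, rcons (take l z0) true) :: pass0 I2)
      G _ _ GY Ll; last first.
  - by exists sigma; apply: completes_grow growJ c.
  - rewrite EG; apply: cat_groups => //; rewrite -[_ :: pass0 I2]cat1s -[g :: G2]cat1s.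
    apply: cat_groups => //; by rewrite Eg g00 /groups /= g1N p1.
  - by rewrite -addn1; apply: level_grow growJ.
have [||||sigma c] := IH l.+1 (pass0 I1 ++ fork true (take l z0) ++ pass0 I2)
    (G1 ++ [:: g0; g1] ++ G2).
- by apply: level_move; rewrite -Ex -EI.
- apply: cat_groups => //; apply: cat_groups => //.
  by rewrite /groups /= g0N g1N p0 p1.
- by rewrite -GY EG !flatten_cat /= [in RHS]Eg -!catA.
- by [].
by exists ((true, size I1) :: sigma); rewrite EI Ex; apply: completes_move.
Qed.

(** * The irrationality of pi *)

Section PiIrrational.
Local Open Scope R_scope.

Let u (x : R) : R := x * (PI - x).

(** The values at [n] and [n + 1] of [1/n!] times the integral of [(x (PI - x))^n sin x] over
    [[0, PI]], given by their two-term recursion. *)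
Fixpoint niven_pair (n : nat) : R * R :=
  if n is n'.+1 then
    let: (k0, k1) := niven_pair n' in
    (k1, (4 * INR n' + 6) * k1 - PI ^ 2 * k0)
  else (2, 4).

Let K n := (niven_pair n).1.

Let K_rec n : K n.+2 = (4 * INR n + 6) * K n.+1 - PI ^ 2 * K n.
Proof. by rewrite /K /=; case: (niven_pair n). Qed.

(** The boundary terms of two integrations by parts; they vanish at 0 and [PI] together with [u] and
    [sin]. *)
Let F n (x : R) : R := - u x ^ n.+1 * cos x + INR n.+1 * u x ^ n * (PI - 2 * x) * sin x.

Let is_RInt_boundary n (f : R -> R) :
    (forall x, is_derive (F n) x (f x)) -> (forall x, continuous f x) ->
  is_RInt f 0 PI 0.
Proof.
move=> dF cf; have := is_RInt_derive (F n) f 0 PI (fun x _ => dF x) (fun x _ => cf x).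
suff -> : minus (F n PI) (F n 0) = 0 by [].
by rewrite /F /u sin_PI sin_0 /minus /plus /opp /=; ring.
Qed.

(* The identity behind the recursion: integrate twice by parts and use
   [u'^2 = PI^2 - 4 u], [u'' = -2]. *)
Let niven_integral n : is_RInt (fun x => u x ^ n * sin x) 0 PI (INR (Factorial.fact n) * K n).
Proof.
have cont (f : R -> R) : (forall x, ex_derive f x) -> forall x, continuous f x.
  by move=> H x; apply: ex_derive_continuous.
have base0 : is_RInt (fun x => u x ^ 0 * sin x) 0 PI (INR (Factorial.fact 0) * K 0).
  have -> : INR (Factorial.fact 0) * K 0 = minus (- cos PI) (- cos 0).
    by rewrite cos_PI cos_0 /K /minus /plus /opp /=; ring.
  apply: (is_RInt_derive (fun x => - cos x)) => x _.
    by auto_derive => //=; ring.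
  by apply: cont => y; rewrite /u; auto_derive.
suff : is_RInt (fun x => u x ^ n * sin x) 0 PI (INR (Factorial.fact n) * K n) /\
       is_RInt (fun x => u x ^ n.+1 * sin x) 0 PI (INR (Factorial.fact n.+1) * K n.+1) by case.
elim: n => [|n [IH0 IH1]]; split => //.
  have H : is_RInt (fun x => (u x - 2) * sin x) 0 PI 0.
    apply: (is_RInt_boundary (n := 0)) => x; last by apply: cont => y; rewrite /u; auto_derive.
    by rewrite /F /u; auto_derive => //=; ring.
  have := is_RInt_plus _ _ _ _ _ _ H (is_RInt_scal _ _ _ 2 _ base0).
  have -> : plus 0 (scal 2 (INR (Factorial.fact 0) * K 0)) = INR (Factorial.fact 1) * K 1.
    by rewrite /plus /scal /= /mult /= /K /=; ring.
  apply: is_RInt_ext => x _; rewrite /plus /scal /= /mult /=; ring.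
pose c := INR n.+2.
have H : is_RInt (fun x => (u x ^ n.+2 + c * INR n.+1 * u x ^ n * (PI ^ 2 - 4 * u x) -
    2 * c * u x ^ n.+1) * sin x) 0 PI 0.
  apply: (is_RInt_boundary (n := n.+1)) => x; last by apply: cont => y; rewrite /u; auto_derive.
  rewrite /F /u /c; auto_derive => //.
  rewrite /= -/(INR n.+1) !S_INR /Rminus.
  by move: (_ ^ n) => un; ring.
have := is_RInt_plus _ _ _ _ _ _ H (is_RInt_plus _ _ _ _ _ _
  (is_RInt_scal _ _ _ (c * (4 * INR n + 6)) _ IH1)
  (is_RInt_scal _ _ _ (- (c * INR n.+1 * PI ^ 2)) _ IH0)).
have -> : plus 0 (plus (scal (c * (4 * INR n + 6)) (INR (Factorial.fact n.+1) * K n.+1))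
    (scal (- (c * INR n.+1 * PI ^ 2)) (INR (Factorial.fact n) * K n))) =
    INR (Factorial.fact n.+2) * K n.+2.
  have factS m : INR (Factorial.fact m.+1) = INR m.+1 * INR (Factorial.fact m).
    by rewrite -mult_INR.
  rewrite K_rec !factS /c /plus /scal /= /mult -/(INR n.+1) !S_INR /=; ring.
apply: is_RInt_ext => x _; rewrite /plus /scal /= /mult /c -/(INR n.+1) !S_INR /=.
ring.
Qed.

Let u_bounds x : 0 < x < PI -> 0 < u x <= 4.
Proof.
move=> xP; split; first by rewrite /u; nra.
(* [4 * u x = PI^2 - (PI - 2 x)^2 <= 16]. *)
have := PI_4; have := Rle_0_sqr (PI - 2 * x); rewrite /u /Rsqr; nra.
Qed.

Let K_bounds n : 0 < INR (Factorial.fact n) * K n <= 4 * 4 ^ n.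
Proof.
have I := @niven_integral n.
rewrite -{1}(is_RInt_unique _ _ _ _ I); split.
  apply: RInt_gt_0; first exact: PI_RGT_0.
    move=> x xP; apply: Rmult_lt_0_compat; last by apply: sin_gt_0; lra.
    by apply: pow_lt; case: (u_bounds xP).
  by move=> x _; apply: ex_derive_continuous; rewrite /u; auto_derive.
apply: (Rle_trans _ (PI * 4 ^ n)); last first.
  by have := PI_4; have : 0 < 4 ^ n by [apply: pow_lt; lra]; nra.
have C := is_RInt_const 0 PI (4 ^ n : R).
apply: (is_RInt_le _ _ _ _ _ _ _ I).
- by apply: Rlt_le; exact: PI_RGT_0.
- by move: C; rewrite /scal /= /mult /= Rminus_0_r; apply.
move=> x xP; have [u0 u4] := u_bounds xP.
have : u x ^ n <= 4 ^ n by apply: pow_incr; lra.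
have := pow_lt _ n u0; have := SIN_bound x.
have : 0 < sin x by apply: sin_gt_0; lra.
nra.
Qed.

Let K_integral a b : PI * IZR b = IZR a -> forall n, exists z, IZR b ^ n * K n = IZR z.
Proof.
move=> ab n; suff : (exists z, IZR b ^ n * K n = IZR z) /\
    exists z, IZR b ^ n.+1 * K n.+1 = IZR z by case.
elim: n => [|n [[z0 E0] [z1 E1]]].
  by split; [exists 2%Z|exists (4 * b)%Z]; rewrite ?mult_IZR /K /=; ring.
split; first by exists z1.
exists ((4 * Z.of_nat n + 6) * b * z1 - a * a * z0)%Z.
rewrite minus_IZR !mult_IZR plus_IZR mult_IZR -INR_IZR_INZ -E0 -E1 -ab K_rec /=.
ring.
Qed.

Lemma PI_irrational q : PI <> Q2R q.
Proof.
move=> piq; pose b := Zpos (Qden q); pose a := Qnum q.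
have b0 : 0 < IZR b by apply: IZR_lt.
have ab : PI * IZR b = IZR a by rewrite piq /Q2R -/a -/b Rmult_assoc Rinv_l ?Rmult_1_r //; lra.
(* For this [N] the positive integer [b^N * K N] is at most [4 * (4 b)^N / N!], hence below 1. *)
have [N NP] := cv_speed_pow_fact (4 * IZR b) (/ 4) ltac:(lra).
have := NP N (le_n _); rewrite /Rdist Rminus_0_r => small.
have [z zE] := K_integral ab N.
have [K0 K4] := K_bounds N.
have f0 := INR_fact_lt_0 N.
have KN0 : 0 < K N by nra.
have bN : 0 < IZR b ^ N by apply: pow_lt.
have z1 : 1 <= IZR z.
  by apply: (IZR_le 1); have : (0 < z)%Z by [apply: lt_IZR; rewrite -zE; nra]; lia.
have := Rle_abs ((4 * IZR b) ^ N / INR (Factorial.fact N)).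
rewrite Rpow_mult_distr in small *.
set r := _ / _ in small * => rr.
have rE : r * INR (Factorial.fact N) = 4 ^ N * IZR b ^ N by rewrite /r; field; lra.
have r4 : r < / 4 by lra.
have : IZR b ^ N * (INR (Factorial.fact N) * K N) <= IZR b ^ N * (4 * 4 ^ N).
  by apply: Rmult_le_compat_l => //; lra.
nra.
Qed.

End PiIrrational.

(** * The dense local order as a coloured linear order *)

Section CutCircle.
Local Open Scope R_scope.
Implicit Types x y z : S2vert.

(* Cutting the circle at the angles [0] and [PI] and folding the upper half onto
   the lower one turns S(2) into a dense linear order with two dense colours. *)
Definition col x : bool := if Rle_dec PI (S2angle x) then true else false.
Definition base x : R := S2angle x - (if col x then PI else 0).
Definition blt x y : bool := if Rlt_dec (base x) (base y) then true else false.

Lemma bltP x y : reflect (base x < base y) (blt x y).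
Proof. by rewrite /blt; case: Rlt_dec => h; constructor. Qed.

Lemma base_bounds x : 0 <= base x < PI.
Proof.
rewrite /base /col; case: (proj2_sig x) => _; rewrite -/(S2angle x).
by case: Rle_dec => /=; lra.
Qed.

Lemma S2angle_inj x y : S2angle x = S2angle y -> x = y.
Proof.
case: x y => [x px] [y py]; rewrite /S2angle /= => E; subst.
by congr exist; apply: Prop_irrelevance.
Qed.

(** No two vertices are antipodal, which makes [base] injective. *)
Lemma S2angle_diff x y : S2angle x - S2angle y <> PI.
Proof.
rewrite /S2angle; case: (proj2_sig x) (proj2_sig y) => -[p ->] _ [[q ->] _].
by rewrite -Qreals.Q2R_minus => E; apply: (PI_irrational (q := (p - q)%Q)).
Qed.

Lemma base_inj x y : base x = base y -> x = y.
Proof.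
move=> E; apply: S2angle_inj; have := @S2angle_diff x y; have := @S2angle_diff y x.
by move: E; rewrite /base; case: (col x); case: (col y); lra.
Qed.

Lemma bltxx x : blt x x = false.
Proof. by apply/bltP; lra. Qed.

Lemma blt_trans y x z : blt x y -> blt y z -> blt x z.
Proof. by move=> /bltP xy /bltP yz; apply/bltP; lra. Qed.

Lemma blt_total x y : x <> y -> blt y x = ~~ blt x y.
Proof.
move=> xy; have nE : base x <> base y by move=> /base_inj.
by apply/bltP/idP => [?|/bltP ?]; [apply/bltP|]; lra.
Qed.

(** Arcs between vertices of one colour follow [base]; moving one endpoint to its antipode reverses
    the arc. *)
Lemma S2arcP x y : x <> y -> (S2arc x y <-> blt x y (+) (col x (+) col y)).
Proof.
move=> xy; have nE : base x <> base y by move=> /base_inj.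
have := base_bounds x; have := base_bounds y.
rewrite /S2arc /arg_quot.
have -> : S2angle x = base x + (if col x then PI else 0) by rewrite /base; lra.
have -> : S2angle y = base y + (if col y then PI else 0) by rewrite /base; lra.
by case: bltP => b; case: (col x); case: (col y); case: Rle_dec => /= h ? ?; split=> // *; lra.
Qed.

Lemma S2arcxx x : ~ S2arc x x.
Proof. by rewrite /S2arc /arg_quot; case: Rle_dec => /= h [? ?]; lra. Qed.

Definition S2code x : nat :=
  let q := projT1 (cid (proj1 (proj2_sig x))) in
  pickle ((0 <=? Qnum q)%Z, Z.abs_nat (Qnum q), Pos.to_nat (Qden q)).

Lemma S2code_inj x y : S2code x = S2code y -> x = y.
Proof.
rewrite /S2code; case: cid => p px; case: cid => q qy /=.
move=> /(pcan_inj pickleK)[E1 E2 /Pos2Nat.inj E3]; apply: S2angle_inj.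
rewrite /S2angle px qy; congr Q2R; case: p q E1 E2 E3 {px qy} => [p1 p2] [q1 q2] /=.
by move=> E1 E2 ->; congr Qmake; lia.
Qed.

Lemma rational_between (a b : R) : a < b -> exists q : Q, a < Q2R q < b.
Proof.
move=> ab; pose n := Z.to_pos (up (/ (b - a))).
have ba : 0 < / (b - a) by apply: Rinv_0_lt_compat; lra.
have [up1 _] := archimed (/ (b - a)).
have nE : IZR (Zpos n) = IZR (up (/ (b - a))).
  by rewrite /n Z2Pos.id //; apply: lt_IZR; lra.
have n0 : 0 < IZR (Zpos n) by lra.
have [m1 m2] := archimed (a * IZR (Zpos n)).
exists (Qmake (up (a * IZR (Zpos n))) n); rewrite /Q2R /=.
set m := IZR (up _) in m1 m2 *; have nab : 1 < (b - a) * IZR (Zpos n).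
  by rewrite -(Rinv_r (b - a)); [apply: Rmult_lt_compat_l; lra|lra].
have := Rinv_l (IZR (Zpos n)) ltac:(lra); have := Rinv_0_lt_compat _ n0.
set r := / _ => r0 rn.
have E c : c * IZR (Zpos n) * r = c by rewrite Rmult_assoc [_ * r]Rmult_comm rn Rmult_1_r.
by rewrite -{1}(E a) -(E b); split; apply: Rmult_lt_compat_r => //; lra.
Qed.

Lemma S2_between (a b : R) (c : bool) : 0 <= a < b -> b <= PI ->
  exists x, [/\ a < base x, base x < b & col x = c].
Proof.
move=> [a0 ab] bP; pose s := if c then PI else 0.
have [|q [qa qb]] := @rational_between (a + s) (b + s); first by lra.
have qv : (exists q' : Q, Q2R q = Q2R q') /\ 0 <= Q2R q < 2 * PI.
  by split; [exists q|move: qa qb; rewrite /s; case: c {s}; have := PI_RGT_0; lra].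
exists (exist _ (Q2R q) qv).
have cE : col (exist _ (Q2R q) qv) = c.
  rewrite /col /S2angle /=; move: qa qb; rewrite /s.
  by case: c {s}; case: Rle_dec => //= h ? ?; exfalso; lra.
by rewrite /base cE /S2angle /= -/s; split => //; lra.
Qed.

Definition mid_split (iv : R * R) (b : bool) : R * R :=
  if b then ((iv.1 + iv.2) / 2, iv.2) else (iv.1, (iv.1 + iv.2) / 2).

Definition dyadic (iv : R * R) (s : node) : R * R := foldl mid_split iv s.

Lemma dyadic_sub iv s : iv.1 < iv.2 ->
  [/\ iv.1 <= (dyadic iv s).1, (dyadic iv s).1 < (dyadic iv s).2 & (dyadic iv s).2 <= iv.2].
Proof.
elim: s iv => [|b s IH] iv ab /=; first by split; lra.
have [] := IH (mid_split iv b); first by case: b; rewrite /mid_split /=; lra.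
by rewrite -/(dyadic _ _); case: b; rewrite /mid_split /= => *; split; lra.
Qed.

Lemma dyadic_nlt iv s t : iv.1 < iv.2 -> nlt s t -> (dyadic iv s).2 <= (dyadic iv t).1.
Proof.
elim: s t iv => [|a s IH] [|b t] iv //= ab; case: eqP => [<-|ne].
  by apply: IH; case: a; rewrite /mid_split /=; lra.
case: a b ne => -[] // _ _.
have [_ _ u] := @dyadic_sub (mid_split iv false) s ltac:(rewrite /mid_split /=; lra).
have [l _ _] := @dyadic_sub (mid_split iv true) t ltac:(rewrite /mid_split /=; lra).
by move: u l; rewrite /dyadic /mid_split /=; lra.
Qed.

(** [e s c] is taken from the dyadic interval of [s]. Incomparable words have intervals without
    common interior, ordered like the words. *)
Lemma S2_universal (a b : R) : 0 <= a < b -> b <= PI ->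
  exists e : node -> bool -> S2vert,
    [/\ forall s c, a < base (e s c) < b, forall s c, col (e s c) = c &
        forall s t c d, nlt s t -> blt (e s c) (e t d)].
Proof.
move=> [a0 ab] bP.
have H (sc : node * bool) : exists x, [/\ (dyadic (a, b) sc.1).1 < base x,
    base x < (dyadic (a, b) sc.1).2 & col x = sc.2].
  have [l m u] := @dyadic_sub (a, b) sc.1 ab; rewrite /= in l m u.
  by apply: S2_between; lra.
have [e eP] := choice H; exists (fun s c => e (s, c)); split.
- move=> s c; have [/= l u _] := eP (s, c).
  by have [/= l' _ u'] := @dyadic_sub (a, b) s ab; lra.
- by move=> s c; have [] := eP (s, c).
- move=> s t c d st; apply/bltP.
  have [_ /= u _] := eP (s, c); have [/= l _ _] := eP (t, d).
  by have := @dyadic_nlt (a, b) s t ab st; lra.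
Qed.

End CutCircle.

Lemma nlt_nth l s t : l < size s -> l < size t -> take l s = take l t ->
  nth false s l = false -> nth false t l -> nlt s t.
Proof.
move=> ls lt st s0 t1; apply/nltP; exists (take l s).
have -> : rcons (take l s) false = take l.+1 s by rewrite (take_nth false) // s0.
have -> : rcons (take l s) true = take l.+1 t by rewrite st (take_nth false) // t1.
by rewrite !prefix_take.
Qed.

(** * The words of the points of S(2) *)

Section TreeOfS2.
Implicit Types w x y z : S2vert.

(* The points are inserted one by one in the order of [S2code], the [m]-th one
   between the levels [3 m] and [3 m + 3]: the branch of the interval containing it
   splits into the points below it and the others at level [3 m], the latter into
   the point itself and the points above it at level [3 m + 1], and the branch of
   the point ends at level [3 m + 2]. *)
Definition hit (m : nat) y : bool :=
  `[< exists x, [/\ S2code x = m, x = y \/ blt x y &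
        forall w, S2code w < m -> blt w y = blt w x] >].

Definition letter (l : nat) y : bool :=
  hit (l %/ 3) y && ((l %% 3 == 0) || (l %% 3 == 1) && (l %/ 3 != S2code y)).

Definition delta y : node := mkseq (letter^~ y) (3 * S2code y + 2).

Lemma size_delta y : size (delta y) = 3 * S2code y + 2.
Proof. exact: size_mkseq. Qed.

Lemma delta_size_inj y z : size (delta y) = size (delta z) -> y = z.
Proof. by rewrite !size_delta => E; apply: S2code_inj; lia. Qed.

Lemma nth_delta l y : l < size (delta y) -> nth false (delta y) l = letter l y.
Proof. by rewrite size_delta => ly; rewrite nth_mkseq. Qed.

Lemma eq_take_delta l y z : l <= size (delta y) -> l <= size (delta z) ->
  (forall i, i < l -> letter i y = letter i z) -> take l (delta y) = take l (delta z).
Proof.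
move=> ly lz H; apply: (@eq_from_nth _ false); rewrite !size_takel //.
move=> i il; rewrite !nth_take // !nth_delta ?H //; exact: leq_trans il _.
Qed.

(** Points that no point of code below [m] separates share an interval up to level [3 m]. *)
Lemma letter_agree m y z i : m <= S2code y -> m <= S2code z ->
  (forall w, S2code w < m -> blt w y = blt w z) -> i < 3 * m ->
  letter i y = letter i z.
Proof.
move=> my mz H im; have i3 : i %/ 3 < m by rewrite ltn_divLR // mulnC.
have hit_agree y' z' : m <= S2code y' -> m <= S2code z' ->
    (forall w, S2code w < m -> blt w y' = blt w z') -> hit (i %/ 3) y' -> hit (i %/ 3) z'.
  move=> my' mz' H' /asboolP[x [xi [xy|xy] xw]].
    by move: my'; rewrite -xy xi leqNgt i3.
  apply/asboolP; exists x; split => //; first by right; rewrite -H' ?xi.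
  by move=> w wi; rewrite -xw // H' // (ltn_trans wi).
rewrite /letter; congr (_ && (_ || _ && _)); last first.
  by rewrite !ltn_eqF // (leq_trans i3).
by apply/idP/idP; apply: hit_agree => // w wm; rewrite H.
Qed.

Lemma delta_nlt y z : blt y z -> nlt (delta y) (delta z).
Proof.
move=> yz.
have yz_asym : ~~ blt z y by apply/negP => zy; have := blt_trans yz zy; rewrite bltxx.
(* The point [x] of least code among those from [y] to [z], ends included, is the first to separate
   them: at level [3 m] if [y] is below [x], at level [3 m + 1] if [x = y]. *)
pose P m := `[< exists x, [/\ S2code x = m, ~~ blt x y & ~~ blt z x] >].
have Py : P (S2code y) by apply/asboolP; exists y; rewrite bltxx.
have Pz : P (S2code z) by apply/asboolP; exists z; rewrite bltxx.
case: (ex_minnP (ex_intro (fun m => P m) _ Py)) => m /asboolP[x [xm xy zx]] mmin.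
have my := mmin _ Py; have mz := mmin _ Pz.
have H w : S2code w < m -> blt w y = blt w z.
  move=> wm; have [wy|wy] := boolP (blt w y); first by rewrite (blt_trans wy yz).
  have [zw|zw] := boolP (blt z w).
    by apply/esym/negP => wz; have := blt_trans wz zw; rewrite bltxx.
  by move: wm; rewrite ltnNge mmin //; apply/asboolP; exists w.
have Hx w : S2code w < m -> blt w z = blt w x.
  move=> wm; apply/idP/idP => [wz|wx].
    have [<-//|/blt_total xyE] := pselect (y = x); first by rewrite H.
    by rewrite -H // in wz; apply: blt_trans wz _; rewrite xyE in xy; move: xy; rewrite negbK.
  have [<-//|/blt_total zxE] := pselect (x = z).
  by apply: blt_trans wx _; move: zx; rewrite zxE negbK.
have hz : hit m z.
  apply/asboolP; exists x; split => //.
  have [->|/blt_total zxE] := pselect (x = z); [by left|right].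
  by move: zx; rewrite zxE negbK.
have [m0 m1] : (3 * m) %/ 3 = m /\ (3 * m) %% 3 = 0 by rewrite mulKn // modnMr.
have [k0 k1] : (3 * m + 1) %/ 3 = m /\ (3 * m + 1) %% 3 = 1.
  by rewrite mulnC divnMDl // modnMDl addn0.
have [xyE|xNy] := pselect (x = y).
  have mlt : m < S2code z.
    rewrite ltn_neqAle mz andbT -xm xyE; apply/eqP => /S2code_inj E.
    by move: yz; rewrite E bltxx.
  have sy : 3 * m + 1 < size (delta y) by rewrite size_delta; lia.
  have sz : 3 * m + 1 < size (delta z) by rewrite size_delta; lia.
  apply: (@nlt_nth (3 * m + 1)) => //.
  - apply: eq_take_delta; [exact: ltnW|exact: ltnW|] => i.
    rewrite addn1 ltnS leq_eqVlt => /predU1P[->|].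
      rewrite /letter m0 m1 /= !andbT hz; apply/asboolP; exists x; split => //; first by left.
      by move=> w wm; rewrite xyE.
    exact: letter_agree.
  - by rewrite nth_delta // /letter k0 k1 -xyE xm /= eqxx andbF.
  - by rewrite nth_delta // /letter k0 k1 hz /= ltn_eqF.
have sy : 3 * m < size (delta y) by rewrite size_delta; lia.
have sz : 3 * m < size (delta z) by rewrite size_delta; lia.
apply: (@nlt_nth (3 * m)) => //.
- by apply: eq_take_delta; [exact: ltnW|exact: ltnW|] => i; apply: letter_agree.
- rewrite nth_delta // /letter m0 m1 /= andbT; apply/asboolP => -[x' [x'm + _]].
  by have -> : x' = x by [apply: S2code_inj; rewrite x'm xm]; case => // E; rewrite E in xy.
- by rewrite nth_delta // /letter m0 m1 /= hz.
Qed.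

(** A letter [true] at level [l] reveals the interval into which the point of code [l %/ 3] is
    inserted, hence the branch up to [l]. *)
Lemma delta_true_unique y z l : l < size (delta y) -> l < size (delta z) ->
  nth false (delta y) l -> nth false (delta z) l -> take l (delta y) = take l (delta z).
Proof.
move=> ly lz; rewrite !nth_delta // /letter => /andP[hy /orP ry] /andP[hz _].
move: (hy) (hz) => /asboolP[x [xm _ xy]] /asboolP[x' [x'm _ xz]].
have E : x' = x by apply: S2code_inj; rewrite xm.
have H w : S2code w < l %/ 3 -> blt w y = blt w z by move=> wl; rewrite xy // xz // E.
have lE := divn_eq l 3.
have my : l %/ 3 <= S2code y.
  by rewrite -ltnS ltn_divLR //; move: ly; rewrite size_delta; lia.
have mz : l %/ 3 <= S2code z.
  by rewrite -ltnS ltn_divLR //; move: lz; rewrite size_delta; lia.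
apply: eq_take_delta; [exact: ltnW|exact: ltnW|] => i il.
have [im|im] := ltnP i (3 * (l %/ 3)); first exact: letter_agree im.
have -> : i = 3 * (l %/ 3) by case: ry => [/eqP|/andP[/eqP]]; lia.
by rewrite /letter mulKn // modnMr hy hz.
Qed.

(** Leaves end at levels congruent to 2 modulo 3, where every letter is [false]. *)
Lemma delta_leaf_level y z : size (delta y) < size (delta z) ->
  nth false (delta z) (size (delta y)) = false.
Proof.
move=> yz; rewrite nth_delta // size_delta /letter mulnC.
by rewrite modnMDl andbF.
Qed.

End TreeOfS2.

(** * Realizing codes in a coloured dense tree *)

Lemma nlt_cut u v x y : size u = size v -> nlt x y ->
  prefix u x -> prefix v y -> u = v \/ nlt u v.
Proof.
move=> uv xy ux vy; have [->|uNv] := eqVneq u v; [by left|right].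
have /orP[//|vu] := nlt_same_size uv uNv.
by move: (nlt_asym (nlt_prefix vy ux vu)); rewrite xy.
Qed.

Lemma prefix_comparable (p q x : node) : prefix p x -> prefix q x ->
  size p <= size q -> prefix p q.
Proof.
by move=> /prefixP[w ->] /prefixP[v E] pq; rewrite prefixE -(takel_cat v pq) -E take_size_cat.
Qed.

(* [back sigma c] lists colours for the branches of a state from which [sigma] leads
   to leaves with colours [c]; only the colours of branches ended next matter. *)
Fixpoint back (sigma : seq move) (c : seq bool) : seq bool :=
  if sigma is m :: sigma' then
    let c' := back sigma' c in
    if m.1 then take m.2 c' ++ drop m.2.+1 c' else c'
  else c.

Section Realization.
Variable d : node -> bool -> node.
Hypothesis d_nlt : forall s t a b, nlt s t -> nlt (d s a) (d t b).
Hypothesis d_true : forall s t a b l, l < size (d s a) -> l < size (d t b) ->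
  nth false (d s a) l -> nth false (d t b) l -> take l (d s a) = take l (d t b).
Hypothesis d_leaf : forall s t a b, size (d s a) < size (d t b) ->
  nth false (d t b) (size (d s a)) = false.

Definition above (s u : node) : Prop := forall s' b, prefix s s' -> prefix u (d s' b).

(** Living branches are kept big: with a full cone of points of both colours above it, a branch can
    still be split or ended. *)
Definition big (u : node) : Prop := exists s, above s u.

Lemma above_sub s s' u u' : prefix s s' -> prefix u' u -> above s u -> above s' u'.
Proof.
by move=> ss' u'u H t b st; apply: prefix_trans u'u (H _ _ (prefix_trans ss' st)).
Qed.

(** A point ending at [u] would be a prefix of the points in the sibling cone, but [d] keeps
    incomparable words incomparable. *)
Lemma above_size s u a w b : above s u -> size u < size (d (s ++ a :: w) b).
Proof.
move=> H; have us := H _ b (prefix_prefix s (a :: w)).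
rewrite ltn_neqAle size_prefix // andbT; apply/eqP => E.
have {us}uE : u = d (s ++ a :: w) b.
  case/prefixP: us E => v ->; rewrite size_cat -{1}[size u]addn0 => /addnI/esym/size0nil ->.
  by rewrite cats0.
have := H _ b (prefix_prefix s [:: ~~ a]); rewrite uE.
apply/negP; case: a {E uE}; [apply: nltNprefix_sym|apply: nltNprefix]; apply: d_nlt;
  by rewrite nlt_catl.
Qed.

(** If a point of the left cone takes [true] after [u], then so do all points of the right cone,
    which lie further right. Otherwise the whole left cone takes [false]. *)
Lemma above_child s u : above s u ->
  exists a s', prefix s s' /\ above s' (rcons u a).
Proof.
move=> H; have Hn a w b : prefix u (d (s ++ a :: w) b) := H _ b (prefix_prefix s _).
have [[w [b t]]|no] := pselect (exists w b, nth false (d (s ++ false :: w) b) (size u)).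
  exists true, (s ++ [:: true]); split; first exact: prefix_prefix.
  move=> _ c /prefixP[v ->]; rewrite -catA /=.
  apply: prefix_letter; [exact: Hn|exact: above_size|].
  apply: (nlt_letter (s := d (s ++ false :: w) b)) t => //; try exact: above_size.
    have /prefixP[v1 ->] := Hn false w b; have /prefixP[v2 ->] := Hn true v c.
    by rewrite !take_size_cat.
  by apply: d_nlt; rewrite nlt_catl.
exists false, (s ++ [:: false]); split; first exact: prefix_prefix.
move=> _ c /prefixP[v ->]; rewrite -catA /=.
apply: prefix_letter; [exact: Hn|exact: above_size|].
by apply/negbTE/negP => t; apply: no; exists v, c.
Qed.

Lemma above_extend n s u : above s u ->
  exists s' u', [/\ prefix s s', prefix u u', size u' = size u + n & above s' u'].
Proof.
elim: n => [|n IH] H; first by exists s, u; rewrite !prefix_refl addn0.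
have [s1 [u1 [ss1 uu1 su1 H1]]] := IH H.
have [a [s2 [s12 H2]]] := above_child H1.
exists s2, (rcons u1 a); split => //.
- exact: prefix_trans s12.
- exact: prefix_trans (prefix_rcons _ _).
- by rewrite size_rcons su1 addnS.
Qed.

(** Two cones alone might follow one branch arbitrarily long. A point [z] between them forces them
    apart: a common node longer than [z] would have to leave [z] on both sides. *)
Lemma big_split u : big u ->
  exists w, [/\ prefix u w, big (rcons w false) & big (rcons w true)].
Proof.
case=> s H; pose z := d (s ++ [:: false; true]) true.
have uz : size u < size z := above_size _ _ _ H.
have sub v : above (s ++ v) u by apply: above_sub H; [exact: prefix_prefix|exact: prefix_refl].
have [sa [ua [ssa uua sua Ha]]] := above_extend ((size z).+1 - size u) (sub [:: false; false]).
have [sb [ub [ssb uub sub' Hb]]] := above_extend ((size z).+1 - size u) (sub [:: true]).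
have {}sua : size ua = (size z).+1 by rewrite sua subnKC // ltnW // ltnW.
have {}sub' : size ub = (size z).+1 by rewrite sub' subnKC // ltnW // ltnW.
have xz : nlt (d sa true) z.
  apply/d_nlt/(nlt_prefix ssa (prefix_refl _)); by rewrite nlt_catl.
have zy : nlt z (d sb true).
  apply/d_nlt/(nlt_prefix (prefix_refl _) ssb); by rewrite nlt_catl.
have xy : nlt (d sa true) (d sb true).
  apply/d_nlt/(nlt_prefix ssa ssb); by rewrite nlt_catl.
have uax := Ha sa true (prefix_refl _); have uby := Hb sb true (prefix_refl _).
have [E|/nltP[w /andP[w0 w1]]] := nlt_cut (etrans sua (esym sub')) xy uax uby.
  have /nltP[w /andP[wx wz]] := xz; have := nlt_asym zy; case/negP.
  apply/nltP; exists w; rewrite wz andbT; apply: prefix_trans uby; rewrite -E.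
  apply: prefix_comparable wx uax _.
  by rewrite size_rcons sua leqW // -(size_rcons w true) size_prefix.
exists w; split; last 2 first.
- by exists sa; apply: above_sub Ha; [exact: prefix_refl|].
- by exists sb; apply: above_sub Hb; [exact: prefix_refl|].
have [uw|wu] := leqP (size u) (size w).
  apply: (prefix_comparable uua) => //; exact: prefix_trans (prefix_rcons _ _) w0.
have p0 : prefix (rcons w false) u.
  by apply: prefix_comparable w0 uua _; rewrite size_rcons.
have := prefix_comparable (prefix_trans p0 uub) w1; rewrite !size_rcons leqnn.
by move=> /(_ isT); rewrite -!cats1 prefix_catr // eqxx.
Qed.

Fixpoint realizable (I : state) (c : seq bool) : Prop :=
  match I, c with
  | x :: I', a :: c' =>
      (if x.1 then big x.2 else exists s, x.2 = d s a) /\ realizable I' c'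
  | [::], [::] => True
  | _, _ => False
  end.

Lemma realizable_size I c : realizable I c -> size I = size c.
Proof. by elim: I c => [|x I IH] [|a c] //= [_ /IH->]. Qed.

Lemma realizable_cat I1 I2 c1 c2 : size I1 = size c1 ->
  realizable (I1 ++ I2) (c1 ++ c2) <-> realizable I1 c1 /\ realizable I2 c2.
Proof.
elim: I1 c1 => [|x I1 IH] [|a c1] //=; first by split => // -[].
move=> [/IH{}IH]; split; first by case=> ? /IH[].
by case=> -[? ?] ?; split => //; apply/IH.
Qed.

Lemma realizable_grow n I c : realizable I c ->
  exists2 J, all2 (grow n) I J & realizable J c.
Proof.
elim: I c => [|[a u] I IH] [|e c] //=; first by exists [::].
case=> ua /IH[J IJ Jc]; case: a ua => [[s H]|[s ->]].
  have [s' [u' [_ uu' su' H']]] := above_extend n H.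
  exists ((true, u') :: J); rewrite /= /grow /= ?uu' ?su' ?eqxx ?IJ //.
  by split => //; exists s'.
by exists ((false, d s e) :: J); rewrite /= /grow /= ?eqxx ?IJ //; split => //; exists s.
Qed.

(** A big node has a big child, and it is the left one when no point takes [true] there. *)
Lemma realizable_pass0 I c : realizable I c ->
    (forall u, (true, u) \in I -> forall s b, size u < size (d s b) ->
       prefix u (d s b) -> nth false (d s b) (size u) = false) ->
  realizable (pass0 I) c.
Proof.
elim: I c => [|[a u] I IH] [|e c] //= [ua Ic] H; split; last first.
  by apply: IH => // v vI; apply: H; rewrite inE vI orbT.
case: a ua H => // -[s Hs] H; have [a [s' [_ Hs']]] := above_child Hs.
have E : a = false.
  have ltu := above_size false [::] true Hs'.
  have pre := Hs' _ true (prefix_prefix s' [:: false]).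
  rewrite size_rcons in ltu; have := H u (mem_head _ _) _ _ (ltnW ltu).
  case/prefixP: pre => w ->; rewrite cat_rcons prefix_prefix => /(_ isT).
  by rewrite nth_cat ltnn subnn.
by exists s'; rewrite -E.
Qed.

Lemma realize sigma I j c : level j I ->
    sigma \in codes (size sigma) (map fst I) -> realizable I (back sigma c) ->
  exists2 S : seq node, size S = size c &
    completes I sigma [seq d x.1 x.2 | x <- zip S c].
Proof.
elim: sigma I j => [|[b p] sigma IH] I j lI.
  rewrite /=; case: ifP => // dI _; rewrite all_map in dI => Ic.
  have [S sS E] : exists2 S : seq node, size S = size c &
      map snd I = [seq d x.1 x.2 | x <- zip S c].
    elim: I c dI Ic {lI} => [|[[] u] I IHI] [|e c] //=; first by exists [::].
    by move=> /IHI{}IHI [[s ->] /IHI[S <- ->]]; exists (s :: S).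
  by exists S; rewrite // -E; apply: completes_done.
rewrite -[size _]/(size sigma).+1 codesSE size_map => /and3P[/= pI].
rewrite (nth_map (false, [::])) // => p1 sc Ic.
have [I1 [t [I2 [EI sI1]]]] : exists I1 t I2, I = I1 ++ (true, t) :: I2 /\ size I1 = p.
  exists (take p I), (nth (false, [::]) I p).2, (drop p.+1 I).
  rewrite size_takel ?(ltnW pI) //; split => //.
  rewrite -{1}(cat_take_drop p I) (drop_nth (false, [::])) //.
  by case: (nth _ I p) p1 => -[] u.
rewrite {}EI in lI sc Ic *; rewrite -{}sI1 in pI sc Ic *; move: {p1 pI p} Ic.
set L := back sigma c; case: b sc => sc Ic; last first.
  have sL : size L = size I1 + (size I2).+1 by rewrite -(realizable_size Ic) size_cat.
  have [L1 [e [L2 [EL sL1]]]] : exists L1 e L2, L = L1 ++ e :: L2 /\ size I1 = size L1.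
    exists (take (size I1) L), (nth false L (size I1)), (drop (size I1).+1 L).
    by rewrite size_takel ?sL ?leq_addr // -drop_nth ?cat_take_drop // sL -addSnnS ltn_addr.
  move: Ic; rewrite EL => /(realizable_cat _ _ sL1)[Ic1 /= [[s Hs] Ic2]].
  (* The added letter makes [y] longer than [t]. The other living branches are grown to the level of
     this leaf, where [d_leaf] gives them the letter [false]. *)
  pose y := d (s ++ [:: false]) e; have ty : size t < size y := above_size _ _ _ Hs.
  have [J1 IJ1 Jc1] := realizable_grow (size y - size t) Ic1.
  have [J2 IJ2 Jc2] := realizable_grow (size y - size t) Ic2.
  have gI : all2 (grow (size y - size t)) (I1 ++ (true, t) :: I2) (J1 ++ (true, y) :: J2).
    apply: cat_all2 => //=; rewrite IJ2 andbT /grow /= Hs ?prefix_prefix //.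
    by rewrite subnKC ?eqxx // ltnW.
  have lJ := level_grow lI gI; set j' := (j + _) in lJ.
  have jy : size y = j'.
    by have /andP[/allP/(_ (true, y)) + _] := lJ; rewrite mem_cat inE eqxx orbT => /(_ isT)/eqP.
  have leaf0 u : (true, u) \in J1 ++ (true, y) :: J2 -> forall s' b', size u < size (d s' b') ->
      prefix u (d s' b') -> nth false (d s' b') (size u) = false.
    move=> uJ s' b'; have /andP[/allP/(_ _ uJ)/= /eqP -> _] := lJ; rewrite -jy => ys _.
    exact: d_leaf.
  have [||S sS c0] := IH (pass0 J1 ++ fork false y ++ pass0 J2) j'.+1 (level_move _ lJ).
  - rewrite map_fst_move -(grow_flags gI).
    have -> : size J1 = size I1 by rewrite (realizable_size Jc1) (realizable_size Ic1).
    exact: sc.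
  - rewrite -/L EL; apply/realizable_cat; first by rewrite size_map (realizable_size Jc1).
    split; first by apply: realizable_pass0 => // u uJ; apply: leaf0; rewrite mem_cat uJ.
    split; first by exists (s ++ [:: false]).
    by apply: realizable_pass0 => // u uJ; apply: leaf0; rewrite mem_cat inE uJ !orbT.
  exists S => //; apply: completes_grow gI _.
  have -> : size I1 = size J1 by rewrite (realizable_size Jc1) (realizable_size Ic1).
  exact: completes_move.
have sL : size I1 + (size I2).+1 < size L.
  have := realizable_size Ic; rewrite /= -/L !size_cat size_drop size_take /=.
  by case: ltnP; lia.
have [L1 [e1 [e2 [L2 [EL sL1]]]]] : exists L1 e1 e2 L2,
    L = L1 ++ e1 :: e2 :: L2 /\ size I1 = size L1.
  exists (take (size I1) L), (nth false L (size I1)).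
  exists (nth false L (size I1).+1), (drop (size I1).+2 L).
  have s1 : size I1 < size L by lia.
  have s2 : (size I1).+1 < size L by lia.
  by rewrite size_takel ?(ltnW s1) // -!drop_nth ?cat_take_drop.
move: Ic; rewrite /= -/L EL sL1 take_size_cat // -[L1 ++ e1 :: _]cat_rcons.
rewrite drop_size_cat ?size_rcons //.
rewrite -sL1 => /(realizable_cat _ _ sL1)[Ic1 /= [tb Ic2]].
(* Points above [w] take [true] at this level, so by [d_true] the other branches cannot. *)
have [w [tw w0 w1]] := big_split tb.
have tw' := size_prefix tw.
have [J1 IJ1 Jc1] := realizable_grow (size w - size t) Ic1.
have [J2 IJ2 Jc2] := realizable_grow (size w - size t) Ic2.
have gI : all2 (grow (size w - size t)) (I1 ++ (true, t) :: I2) (J1 ++ (true, w) :: J2).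
  by apply: cat_all2 => //=; rewrite IJ2 andbT /grow /= tw subnKC ?eqxx.
have lJ := level_grow lI gI; set j' := (j + _) in lJ.
have jw : size w = j'.
  by have /andP[/allP/(_ (true, w)) + _] := lJ; rewrite mem_cat inE eqxx orbT => /(_ isT)/eqP.
have other0 u : (true, u) \in J1 \/ (true, u) \in J2 -> forall s' b', size u < size (d s' b') ->
    prefix u (d s' b') -> nth false (d s' b') (size u) = false.
  move=> uJ s' b' us' pu; have uj : size u = size w.
    rewrite jw; have /andP[/allP/(_ (true, u)) + _] := lJ; rewrite mem_cat inE.
    by case: uJ => ->; rewrite ?orbT => /(_ isT)/eqP.
  apply/negbTE/negP => ut; have [sw Hw] := w1.
  have pw := Hw _ true (prefix_prefix sw [:: false]).
  have sw' := above_size false [::] true Hw; rewrite size_rcons in sw'.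
  have E : u = w.
    have := d_true us' _ ut; rewrite uj => /(_ (sw ++ [:: false]) true (ltnW sw')).
    move: pu pw; rewrite -{3}uj => /prefixP[v1 ->] /prefixP[v2 ->]; rewrite cat_rcons.
    rewrite nth_cat ltnn subnn /= take_size_cat // take_size_cat //; exact.
  have /andP[_] := lJ; rewrite cat_uniq /= => /and3P[_ /norP[+ _] /andP[+ _]].
  by case: uJ; rewrite E => ->.
have [||S sS c0] := IH (pass0 J1 ++ fork true w ++ pass0 J2) j'.+1 (level_move _ lJ).
- rewrite map_fst_move -(grow_flags gI).
  have -> : size J1 = size I1 by rewrite (realizable_size Jc1) (realizable_size Ic1).
  exact: sc.
- rewrite -/L EL; apply/realizable_cat; first by rewrite size_map (realizable_size Jc1).
  split; first by apply: realizable_pass0 => // u uJ; apply: other0; left.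
  by do !split => //; apply: realizable_pass0 => // u uJ; apply: other0; right.
exists S => //; apply: completes_grow gI _.
have -> : size I1 = size J1 by rewrite (realizable_size Jc1) (realizable_size Ic1).
exact: completes_move.
Qed.

End Realization.

(** * Counting the colourings of a tournament *)

Definition tour n (c : n.-tuple bool) (i j : 'I_n) : bool :=
  (i != j) && ((i < j) (+) (tnth c i (+) tnth c j)).

Section CountColourings.
Variables (T : finType) (E : rel T).
Local Notation n := #|T|.
Implicit Types (c : n.-tuple bool) (f : {ffun 'I_n -> T}).

Definition labels c f : bool :=
  injectiveb f && [forall i, forall j, E (f i) (f j) == tour c i j].

Definition colourings : {set n.-tuple bool} := [set c | [exists f, labels c f]].

Lemma labelsP c f : reflect (injective f /\ forall i j, E (f i) (f j) = tour c i j) (labels c f).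
Proof.
apply: (iffP andP) => [[/injectiveP fi /forallP fE]|[fi fE]]; split.
- exact: fi.
- by move=> i j; have /forallP/(_ j)/eqP := fE i.
- exact/injectiveP.
- by apply/forallP => i; apply/forallP => j; rewrite fE.
Qed.

Let labelled : {set n.-tuple bool * {ffun 'I_n -> T}} := [set cf | labels cf.1 cf.2].

Lemma ffun_bij f : injective f -> bijective f.
Proof. by move=> fi; apply: inj_card_bij fi _; rewrite card_ord. Qed.

(** Automorphisms act freely and transitively on the labellings with a given colour tuple. *)
Lemma card_labelled_Aut : #|labelled| = #|colourings| * #|Aut_tour E|.
Proof.
pose fc c := if [pick f | labels c f] is Some f then f else [ffun i => enum_val i].
have fcP c : c \in colourings -> labels c (fc c).
  by rewrite inE /fc => /existsP[f fl]; case: pickP => // /(_ f); rewrite fl.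
rewrite -cardsX.
pose phi (cp : n.-tuple bool * {perm T}) := (cp.1, [ffun i : 'I_n => cp.2 (fc cp.1 i)]).
have -> : labelled = phi @: finset.setX colourings (Aut_tour E).
  apply/setP => -[c f]; rewrite inE /=; apply/idP/imsetP.
    move=> /labelsP[fi fE].
    have cc : c \in colourings by rewrite inE; apply/existsP; exists f; apply/labelsP.
    have /labelsP[gi gE] := fcP c cc; have [g' gK g'K] := ffun_bij gi.
    have pi : injective (f \o g').
      by move=> x y /= /fi/(congr1 (fc c)); rewrite !g'K.
    exists (c, perm pi) => /=; last by congr (_, _); apply/ffunP => i; rewrite ffunE permE /= gK.
    rewrite inE /= cc inE; apply/forallP => x; apply/forallP => y.
    by rewrite !permE /= fE -gE !g'K.
  move=> [[d p] /=]; rewrite inE /= => /andP[cc]; rewrite inE => /forallP pE [-> ->].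
  have /labelsP[gi gE] := fcP d cc; apply/labelsP; split.
    by move=> i j; rewrite !ffunE => /perm_inj/gi.
  by move=> i j; rewrite !ffunE -gE; have /forallP/(_ (fc d j))/eqP := pE (fc d i).
rewrite card_in_imset // => -[c p] [c' p']; rewrite !inE /= => /andP[cc _] _ [<- fE].
have cc' : c \in colourings by rewrite inE.
have /labelsP[gi _] := fcP c cc'; have [g' gK g'K] := ffun_bij gi.
congr (_, _); apply/permP => x; move/ffunP/(_ (g' x)): fE.
by rewrite !ffunE g'K.
Qed.

Lemma monotone_ge m (h : 'I_m -> 'I_m) : (forall i j : 'I_m, i < j -> h i < h j) ->
  forall i : 'I_m, i <= h i.
Proof.
move=> hm [k km] /=; elim: k km => // k IH km.
apply: leq_ltn_trans (IH (ltnW km)) _; exact: hm.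
Qed.

(* A labelling and its colours are determined by the first vertex and its colour;
   all [2 n] choices arise from one labelling by rotating it, a point which passes
   from the front to the back changing its colour. *)
Lemma card_labelled : 0 < n -> labelled != finset.set0 -> #|labelled| = 2 * n.
Proof.
move=> n0 /finset.set0Pn[[c f]]; rewrite inE /= => cf; have /labelsP[fi fE] := cf.
pose i0 : 'I_n := Ordinal n0.
have -> : 2 * n = #|[set: T * bool]| by rewrite cardsT card_prod card_bool mulnC.
pose psi (cf : n.-tuple bool * {ffun 'I_n -> T}) := (cf.2 i0, tnth cf.1 i0).
have <- : psi @: labelled = finset.setT.
  apply/setP => -[v b]; rewrite inE; apply/imsetP.
  (* The labelling is unrolled over the natural numbers with period [n], colours being switched at
     each lap; any [n] consecutive positions form a labelling. *)
  pose ct a := tnth c (Ordinal (ltn_pmod a n0)) (+) odd (a %/ n).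
  pose ft a := f (Ordinal (ltn_pmod a n0)).
  have Exx x : E x x = false.
    by have [g _ gK] := ffun_bij fi; rewrite -(gK x) fE /tour eqxx.
  have Esym x y : x != y -> E y x = ~~ E x y.
    have [g _ gK] := ffun_bij fi => xy.
    have gxy : g x != g y by apply: contraNneq xy => /(congr1 f); rewrite !gK => ->.
    rewrite -(gK x) -(gK y) !fE /tour eq_sym gxy /=; move: gxy; rewrite -val_eqE /=.
    by case: ltngtP => //= _ _; case: (tnth _ _); case: (tnth _ _).
  have arc a a' : a < a' < a + n -> E (ft a) (ft a') = ~~ (ct a (+) ct a').
    move=> /andP[aa' a'n]; rewrite /ft fE /tour /ct.
    have ma := ltn_pmod a n0; have ma' := ltn_pmod a' n0.
    have Ea := divn_eq a n; have Ea' := divn_eq a' n.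
    rewrite -val_eqE /=.
    have [[q r]|[q r]] : (a' %/ n = a %/ n /\ a %% n < a' %% n) \/
        (a' %/ n = (a %/ n).+1 /\ a' %% n < a %% n).
      have q1 : a %/ n <= a' %/ n by apply: leq_div2r; exact: ltnW.
      have q2 : a' %/ n <= (a %/ n).+1.
        by have := leq_div2r n (ltnW a'n); rewrite divnDr ?dvdnn // divnn n0 addn1.
      have [q|q] : a' %/ n = a %/ n \/ a' %/ n = (a %/ n).+1 by lia.
        by left; split => //; rewrite q in Ea'; lia.
      by right; split => //; rewrite q mulSn in Ea'; lia.
    - rewrite q r ltn_eqF //=; case: (tnth _ _); case: (tnth _ _); case: odd => //.
    - rewrite q ltnNge (ltnW r) gtn_eqF //=; case: (tnth _ _); case: (tnth _ _); case: odd => //.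
  have [g _ gK] := ffun_bij fi.
  (* Starting one lap later keeps the first vertex and switches its colour. *)
  pose k := if tnth c (g v) == b then (g v : nat) else g v + n.
  exists ([tuple ct (i + k) | i < n], [ffun i : 'I_n => ft (i + k)]).
    rewrite inE /=; apply/labelsP.
    have inj : injective [ffun i : 'I_n => ft (i + k)].
      move=> i j; rewrite !ffunE => /fi/(congr1 val)/eqP /=; rewrite eqn_modDr.
      by rewrite !modn_small // => /eqP/val_inj.
    split => // i j; rewrite !ffunE /tour !tnth_mktuple.
    have arc' (i' j' : 'I_n) : i' < j' ->
        E (ft (i' + k)) (ft (j' + k)) = ~~ (ct (i' + k) (+) ct (j' + k)).
      by move=> ij; apply: arc; have := ltn_ord j'; lia.
    have [ij|ji|/val_inj->] := ltngtP i j; last by rewrite eqxx Exx.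
      by rewrite arc' // -val_eqE ltn_eqF.
    rewrite Esym; last first.
      apply/eqP => e; have := inj j i; rewrite !ffunE e => /(_ erefl) E'.
      by rewrite E' ltnn in ji.
    by rewrite arc' // negbK -val_eqE gtn_eqF //= addbC.
  rewrite /psi /= ffunE tnth_mktuple /ft /ct add0n.
  have gn := ltn_ord (g v).
  have -> : Ordinal (ltn_pmod k n0) = g v.
    by apply: val_inj; rewrite /= /k; case: ifP => _; rewrite ?modnDr modn_small.
  rewrite gK; congr (_, _); rewrite /k; case: eqP => [->|/eqP].
    by rewrite divn_small // addbF.
  rewrite divnDr ?dvdnn // divnn n0 divn_small //= addbT.
  by case: (tnth _ _); case: (b).
rewrite card_in_imset // => -[c1 f1] [c2 f2]; rewrite !inE /= => /labelsP[i1 E1] /labelsP[i2 E2].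
rewrite /psi /= => -[v0 b0].
(* Position [i0] precedes all others, so the arcs at the first vertex reveal every colour. *)
pose kappa x := if x == f1 i0 then tnth c1 i0 else tnth c1 i0 (+) ~~ E (f1 i0) x.
have kP c' f' : injective f' -> (forall i j, E (f' i) (f' j) = tour c' i j) ->
    f' i0 = f1 i0 -> tnth c' i0 = tnth c1 i0 -> forall i, tnth c' i = kappa (f' i).
  move=> i' E' v' b' i; rewrite /kappa -v' -b' (inj_eq i') E' /tour.
  case: eqVneq => [->//|/= ii0].
  have -> : i0 < i by rewrite lt0n; apply: contra ii0 => /eqP i_0; apply/eqP/val_inj.
  by case: (tnth _ i0); case: (tnth _ i).
have k1 := kP _ _ i1 E1 erefl erefl; have k2 := kP _ _ i2 E2 (esym v0) (esym b0).
have ltP c' f' : (forall i j, E (f' i) (f' j) = tour c' i j) ->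
    (forall i, tnth c' i = kappa (f' i)) ->
    forall i j : 'I_n, i != j -> (i < j) = E (f' i) (f' j) (+) (kappa (f' i) (+) kappa (f' j)).
  move=> E' k' i j ij; rewrite E' /tour ij /= !k'.
  by case: (i < j); case: (kappa _); case: (kappa _).
(* Arcs and colours determine the order, so passing from one labelling to the other is monotone in
   both directions, hence trivial. *)
have mono c' f' c'' f'' : (forall i j, E (f' i) (f' j) = tour c' i j) ->
    (forall i, tnth c' i = kappa (f' i)) ->
    (forall i j, E (f'' i) (f'' j) = tour c'' i j) ->
    (forall i, tnth c'' i = kappa (f'' i)) ->
    injective f'' ->
    forall g, cancel g f'' -> forall i : 'I_n, injective f' -> i <= g (f' i).
  move=> E' k' E'' k'' i'' g gK i i'; apply: (monotone_ge (h := g \o f')) => a b ab /=.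
  have ne : a != b by rewrite -val_eqE ltn_eqF.
  rewrite (ltP _ _ E'' k'') ?gK; last by rewrite (inj_eq (can_inj gK)) (inj_eq i').
  by rewrite -(ltP _ _ E' k').
have [g1 g1K f1K] := ffun_bij i1; have [g2 g2K f2K] := ffun_bij i2.
have ff : f1 = f2.
  apply/ffunP => i; rewrite -[LHS]f2K; congr (f2 _); apply/val_inj/eqP.
  rewrite eqn_leq (mono _ _ _ _ E1 k1 E2 k2 i2 g2 f2K i i1) andbT.
  have := mono _ _ _ _ E2 k2 E1 k1 i1 g1 f1K (g2 (f1 i)) i2.
  by rewrite f2K g1K.
rewrite ff in k1 *; congr (_, _); apply: eq_from_tnth => i; by rewrite k1 k2.
Qed.

Lemma colourings_Aut : 0 < n -> colourings != finset.set0 ->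
  #|colourings| * #|Aut_tour E| = 2 * n.
Proof.
move=> n0 /finset.set0Pn[c]; rewrite inE => /existsP[f cf].
by rewrite -card_labelled_Aut card_labelled //; apply/finset.set0Pn; exists (c, f); rewrite inE.
Qed.

End CountColourings.

(** * The big Ramsey degree *)

Notation root := [:: (true, [::] : node)].

Definition increasing n (y : 'I_n -> S2vert) : Prop :=
  forall i j : 'I_n, i < j -> blt (y i) (y j).

Definition delta_seq n (y : 'I_n -> S2vert) : seq node := [seq delta (y i) | i <- enum 'I_n].

Definition col_tuple n (y : 'I_n -> S2vert) : n.-tuple bool := [tuple col (y i) | i < n].

Lemma size_delta_seq n (y : 'I_n -> S2vert) : size (delta_seq y) = n.
Proof. by rewrite size_map size_enum_ord. Qed.

Lemma nth_delta_seq n (y : 'I_n -> S2vert) (i : 'I_n) : nth [::] (delta_seq y) i = delta (y i).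
Proof. by rewrite (nth_map i) ?size_enum_ord ?nth_ord_enum. Qed.

Section IncreasingPoints.
Variables (n : nat) (y : 'I_n -> S2vert).
Hypothesis y_incr : increasing y.

Lemma increasing_blt (i j : 'I_n) : blt (y i) (y j) = (i < j).
Proof.
have [ij|ji|/val_inj->] := ltngtP i j; first exact: y_incr.
  by apply/negP => ij; have := blt_trans ij (y_incr ji); rewrite bltxx.
exact: bltxx.
Qed.

Lemma increasing_inj : injective y.
Proof.
move=> i j ij; apply/val_inj/eqP; move: (increasing_blt i j) (increasing_blt j i).
by rewrite ij bltxx; case: ltngtP.
Qed.

Lemma arc_tour i j : S2arc (y i) (y j) <-> tour (col_tuple y) i j.
Proof.
rewrite /tour; case: eqVneq => [->|ij]; first by split => // /S2arcxx.
by rewrite S2arcP ?increasing_blt ?tnth_mktuple // => /increasing_inj/eqP; apply/negP.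
Qed.

Lemma delta_seq_completes : 0 < n -> exists sigma, completes root sigma (delta_seq y).
Proof.
move=> n0; apply: completes_antichain.
- by rewrite -size_eq0 size_delta_seq -lt0n.
- rewrite pairwise_map; apply: (sub_pairwise (r := relpre val ltn)).
    by move=> i j /y_incr/delta_nlt.
  by rewrite -pairwise_map val_enum_ord -sorted_pairwise ?iota_ltn_sorted //; exact: ltn_trans.
- by move=> _ _ /mapP[i _ ->] /mapP[j _ ->] /delta_size_inj ->.
- by move=> _ _ /mapP[i _ ->] /mapP[j _ ->] l; apply: delta_true_unique.
- by move=> _ _ /mapP[i _ ->] /mapP[j _ ->]; apply: delta_leaf_level.
Qed.

Lemma delta_seq_code sigma : completes root sigma (delta_seq y) ->
  sigma \in codes (2 * n - 1) [:: true].
Proof.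
move=> c; have := completes_codes c; have := completes_size c.
rewrite size_delta_seq /= muln1 => E.
by have -> : size sigma = 2 * n - 1 by lia.
Qed.

End IncreasingPoints.

(** Gives a copy, which is only a set of points, a well-defined code and colour pattern. *)
Lemma increasing_unique n (y z : 'I_n -> S2vert) : increasing y -> increasing z ->
  (forall v, (exists i, y i = v) <-> (exists i, z i = v)) -> y = z.
Proof.
move=> iy iz yz.
have [h hP] := choice (fun i => (yz (y i)).1 (ex_intro _ i erefl)).
have [k kP] := choice (fun i => (yz (z i)).2 (ex_intro _ i erefl)).
have hge := @monotone_ge _ h; have kge := @monotone_ge _ k.
apply/funext => i; rewrite -hP; congr z; apply/val_inj/eqP; rewrite eqn_leq.
apply/andP; split; last first.
  by apply: hge => a b ab; rewrite -(increasing_blt iz) !hP (increasing_blt iy).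
have E : k (h i) = i by apply: (increasing_inj iy); rewrite kP hP.
rewrite -{2}E; apply: kge => a b ab.
by rewrite -(increasing_blt iy) !kP (increasing_blt iz).
Qed.

Lemma sort_points (T : finType) (y : T -> S2vert) : injective y ->
  exists2 f : {ffun 'I_#|T| -> T}, injective f & increasing (y \o f).
Proof.
move=> yi; pose r s t := (s == t) || blt (y s) (y t).
have r_total : total r.
  move=> s t; rewrite /r [t == s]eq_sym; case: eqVneq => //= st.
  by rewrite (blt_total (x := y t)) ?orNb // => /yi/esym/eqP; apply/negP.
have r_trans : ssrbool.transitive r.
  move=> s t u /orP[/eqP->//|ts] /orP[/eqP<-|su]; rewrite /r ?ts ?orbT //.
  by rewrite (blt_trans ts su) orbT.
have sz : size (sort r (enum T)) = #|T| by rewrite size_sort -cardE.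
exists [ffun i : 'I_#|T| => nth (enum_val i) (sort r (enum T)) i].
  move=> i j; rewrite !ffunE (set_nth_default (enum_val j)) ?sz // => /eqP.
  by rewrite nth_uniq ?sz ?sort_uniq ?enum_uniq // => /eqP/val_inj.
move=> i j ij /=; rewrite !ffunE (set_nth_default (enum_val j)) ?sz //.
have := sorted_ltn_nth r_trans (enum_val j) (sort_sorted r_total (enum T)).
move=> /(_ i j); rewrite !inE !sz => /(_ (ltn_ord i) (ltn_ord j) ij) /orP[|//].
by rewrite nth_uniq ?sz ?sort_uniq ?enum_uniq // ltn_eqF.
Qed.

Lemma codes_size m l sigma : sigma \in codes m l -> size sigma = m.
Proof.
elim: m l sigma => [|m IH] l [|a sigma] //=; first by case: ifP => // _; rewrite inE.
- by move=> /flattenP[_ /mapP[p _ ->]]; rewrite mem_cat => /orP[] /mapP[].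
- by rewrite -[flatten _]/(codes m.+1 l) codesSE => /and3P[_ _ /IH->].
Qed.

Lemma size_back sigma l c : sigma \in codes (size sigma) l ->
  size sigma + 2 * size l = count idfun l + 2 * size c -> size (back sigma c) = size l.
Proof.
elim: sigma l => [|[b p] sigma IH] l.
  rewrite /=; case: ifP => // dl _ E.
  suff E0 : count idfun l = 0 by lia.
  by apply/eqP; rewrite eqn0Ngt -has_count -all_predC.
rewrite -[size (_ :: _)]/(size sigma).+1 codesSE /= => /and3P[pl lp sc] E.
have cnt := count_move_flags b lp.
have sz : size (move_flags (b, p) l) = size l + b.
  rewrite /move_flags !size_cat size_takel ?(ltnW pl) // size_drop /=.
  by case: b {sc cnt} => /=; lia.
have := IH _ sc; rewrite sz; case: b {IH sc} cnt sz => /= cnt sz H.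
  by rewrite size_cat size_drop size_take H ?addn1 ?ltnS ?(ltnW pl) ?ltnW //; lia.
by rewrite H ?addn0 //; lia.
Qed.

(* Seen from the vertex at angle [0], a copy of S(2) splits into the vertices above
   and below the image of that vertex. The latter precede the former in the source,
   and each part is embedded isomorphically up to a global exchange of colours. *)
Lemma copy_contains_tree (W : S2vert -> Prop) : is_S2_copy W ->
  exists h : node -> bool -> S2vert,
    [/\ forall s b, W (h s b), forall s b, col (h s b) = b &
        forall s t b c, nlt s t -> blt (h s b) (h t c)].
Proof.
move=> [g [gi [Wg gE]]].
have v_angle : (exists q : Q, 0%R = Q2R q) /\ (0 <= 0 < 2 * PI)%R.
  by split; [exists 0%Q; rewrite /Q2R /=; lra|have := PI_RGT_0; lra].
pose v : S2vert := exist _ 0%R v_angle.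
have vc : col v = false.
  by rewrite /col /S2angle /=; case: Rle_dec => // ?; exfalso; have := PI_RGT_0; lra.
have vb : base v = 0%R by rewrite /base vc /S2angle /=; lra.
have v_lt x : x <> v -> blt v x.
  move=> xv; have nE : base x <> base v by move=> /base_inj.
  by apply/bltP; have := base_bounds x; lra.
have gNE x y : x <> y -> g x <> g y by move=> xy /gi.
have arcE x y : x <> y -> blt x y (+) (col x (+) col y) =
    blt (g x) (g y) (+) (col (g x) (+) col (g y)).
  move=> xy; have /= := gE x y; rewrite !S2arcP //; last exact: gNE.
  by move=> H; apply/idP/idP => /H.
pose S x := blt (g v) (g x).
have colE x : x <> v -> col (g x) = col (g v) (+) S x (+) ~~ col x.
  move=> xv; have := arcE v x (fun e => xv (esym e)); rewrite v_lt // vc -/(S x).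
  by case: (S x); case: (col x); case: (col _); case: (col _).
have same x y : x <> v -> y <> v -> x <> y -> S x = S y -> blt (g x) (g y) = blt x y.
  move=> xv yv xy Sxy; have := arcE x y xy; rewrite (colE x) // (colE y) // Sxy.
  by case: (blt x y); case: (blt _ _); case: (S y); case: (col x); case: (col y); case: (col _).
(* Vertices sent above [g v] precede, in the source, those sent below it. *)
have diff x y : x <> v -> y <> v -> S x = false -> S y -> blt y x.
  move=> xv yv Sx Sy; have xy : x <> y by move=> e; rewrite e Sy in Sx.
  have gvx : g v <> g x by move=> /gi e; apply: xv.
  have gxv : blt (g x) (g v) by rewrite (blt_total gvx) -/(S x) Sx.
  have := arcE x y xy.
  rewrite (blt_trans gxv Sy) (colE x) // (colE y) // Sx Sy (blt_total (x := x)) //.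
  by case: (blt x y); case: (col x); case: (col y); case: (col _).
have [m [m0 mP _]] := @S2_between 0%R PI false ltac:(have := PI_RGT_0; lra) ltac:(lra).
have mv : m <> v by move=> e; rewrite e vb in m0; lra.
(* On this side of [m] every vertex has the value [S m]. *)
pose lo := if S m then 0%R else base m; pose hi := if S m then base m else PI.
have lohi : (0 <= lo < hi)%R by rewrite /lo /hi; case: (S m); lra.
have hiP : (hi <= PI)%R by rewrite /hi; case: (S m); lra.
have [e [eb ec en]] := S2_universal lohi hiP.
have ev s c : e s c <> v by move=> E; have := eb s c; rewrite E vb; lra.
have eS s c : S (e s c) = S m.
  have := eb s c; rewrite /lo /hi.
  case Sm : (S m) => eb'; case Se : (S (e s c)) => //; exfalso.
    by have /bltP := diff _ _ (ev s c) mv Se Sm; lra.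
  by have /bltP := diff _ _ mv (ev s c) Sm Se; lra.
(* On that part [g] keeps or exchanges the colours as a whole; [flip] compensates. *)
pose flip := col (g v) (+) ~~ S m.
exists (fun s b => g (e s (b (+) flip))); split.
- by move=> s b; apply/Wg; exists (e s (b (+) flip)).
- by move=> s b; rewrite colE // eS ec /flip; case: b; case: (S m); case: (col _).
- move=> s t b c st; rewrite same ?en // ?eS //.
  by move=> E; have := en _ _ (b (+) flip) (c (+) flip) st; rewrite E bltxx.
Qed.

Lemma realize_in_copy (W : S2vert -> Prop) n sigma (c : n.-tuple bool) :
    is_S2_copy W -> 0 < n -> sigma \in codes (2 * n - 1) [:: true] ->
  exists y : 'I_n -> S2vert, [/\ increasing y, forall i, W (y i),
    completes root sigma (delta_seq y) & col_tuple y = c].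
Proof.
move=> WS n0 sc; have [h [Wh hc hb]] := copy_contains_tree WS.
have ss := codes_size sc; rewrite -ss in sc.
have sb : size (back sigma c) = 1.
  by apply: (size_back (l := [:: true])) => //=; rewrite size_tuple ss; lia.
have [||||S sS cS] := @realize (fun s b => delta (h s b)) _ _ _ sigma root 0 c isT sc.
- by move=> s t a b /hb/delta_nlt; apply.
- by move=> s t a b l; apply: delta_true_unique.
- by move=> s t a b; apply: delta_leaf_level.
- case: (back sigma c) sb => [|a [|]] //= _; split => //.
  by exists [::] => s b _; rewrite prefix0s.
rewrite size_tuple in sS.
pose y (i : 'I_n) := h (nth [::] S i) (tnth c i).
have Dy : delta_seq y = [seq delta (h x.1 x.2) | x <- zip S c].
  apply: (@eq_from_nth _ [::]).
    by rewrite size_delta_seq size_map size_zip sS size_tuple minnn.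
  move=> i; rewrite size_delta_seq => ni; rewrite (nth_delta_seq _ (Ordinal ni)).
  rewrite (nth_map ([::], false)); last by rewrite size_zip sS size_tuple minnn.
  by rewrite nth_zip ?sS ?size_tuple //= /y (tnth_nth false).
exists y; split.
- move=> i j ij; have := completes_sorted cS isT; rewrite -Dy.
  move=> /(pairwiseP [::])/(_ i j); rewrite !inE size_delta_seq.
  move=> /(_ (ltn_ord i) (ltn_ord j) ij); rewrite !nth_delta_seq => yij.
  apply: contrapT => /negP nb.
  have [E|yN] := pselect (y i = y j); first by rewrite E nltxx in yij.
  by have := blt_total yN; rewrite nb => /delta_nlt/nlt_asym; rewrite yij.
- by move=> i; apply: Wh.
- by rewrite Dy.
- by apply: eq_from_tnth => i; rewrite tnth_mktuple hc.
Qed.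

(** * The upper and the lower bound *)

Section RelatedTournament.
Variables (T : finType) (E : rel T).
Hypothesis T_gt0 : 0 < #|T|.

Lemma labels_points (a : T -> S2vert) (y : 'I_#|T| -> S2vert) (f : {ffun 'I_#|T| -> T}) :
    increasing y -> injective f -> (forall s t, S2arc (a s) (a t) <-> E s t) ->
    (forall i j, S2arc (a (f i)) (a (f j)) <-> S2arc (y i) (y j)) ->
  labels E (col_tuple y) f.
Proof.
move=> iy fi aE ay; apply/labelsP; split => // i j.
by apply/idP/idP => [/aE/ay/(arc_tour iy)|/(arc_tour iy)/ay/aE].
Qed.

Lemma colourings_neq0 : in_class E -> colourings E != finset.set0.
Proof.
move=> [a [ai aE]]; have [f fi iy] := sort_points ai.
apply/finset.set0Pn; exists (col_tuple (a \o f)); rewrite inE; apply/existsP; exists f.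
exact: labels_points iy fi aE _.
Qed.

Lemma points_copy (y : 'I_#|T| -> S2vert) : increasing y ->
  col_tuple y \in colourings E -> is_copy E (fun v => exists i, y i = v).
Proof.
move=> iy; rewrite inE => /existsP[f /labelsP[fi fE]]; have [g fK gK] := ffun_bij fi.
exists (y \o g); split; first exact: inj_comp (increasing_inj iy) (can_inj gK).
split => [v|s t]; last by rewrite (arc_tour iy) -fE !gK.
by split=> [[i <-]|[t <-]]; [exists (f i); rewrite /= fK|exists (g t)].
Qed.

Lemma order_embedding_copy (g : S2vert -> S2vert) :
    (forall x y, blt x y -> blt (g x) (g y)) -> (forall x, col (g x) = col x) ->
  injective g /\ forall x y, S2arc (g x) (g y) <-> S2arc x y.
Proof.
move=> gb gc; have gi : injective g.
  move=> x y gxy; apply: contrapT => xy; case xyb : (blt x y).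
    by have := gb _ _ xyb; rewrite gxy bltxx.
  have yx : blt y x by rewrite (blt_total xy) xyb.
  by have := gb _ _ yx; rewrite gxy bltxx.
split => // x y; have [->|xy] := pselect (x = y); first by split => /S2arcxx.
rewrite !S2arcP ?gc //; last by move=> /gi.
have gxy : g x <> g y by move=> /gi.
suff -> : blt (g x) (g y) = blt x y by [].
case xyb : (blt x y); first exact: gb.
have yx : blt y x by rewrite (blt_total xy) xyb.
by have := gb _ _ yx; rewrite (blt_total gxy) => /negbTE.
Qed.

Theorem upper_bound :
  brd_bound E (code_count (2 * #|T| - 1) 1 * #|colourings E|).
Proof.
move=> k k0 chi; set n := #|T|.
have [e [eb ec en]] := @S2_universal 0%R PI ltac:(have := PI_RGT_0; lra) ltac:(lra).
(* One colour records the answers for all colour patterns at once, so homogeneity for a code covers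
   them together. *)
pose chi' (D : seq node) : {ffun n.-tuple bool -> 'I_k} :=
  [ffun c : n.-tuple bool => chi (fun v => exists i : 'I_n, e (nth [::] D i) (tnth c i) = v)].
have [f sf fP] := milliken_seq chi' (codes (2 * n - 1) [:: true]).
have kappaP sigma : exists F, sigma \in codes (2 * n - 1) [:: true] ->
    forall D, completes root sigma D -> chi' (map f D) = F.
  have [[D0 c0]|no] := pselect (exists D0, completes root sigma D0).
    by exists (chi' (map f D0)) => sc D c; apply: fP c c0.
  by exists (chi' [::]) => _ D c; case: no; exists D.
have [kappa {}kappaP] := choice kappaP.
pose g x := e (f (delta x)) (col x).
have gb x y : blt x y -> blt (g x) (g y) by move=> /delta_nlt/(strong_nlt sf)/en; apply.
have [gi gE] := order_embedding_copy gb (fun x => ec _ _).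
exists (fun v => exists u, g u = v); split; first by exists g.
pose cs := [seq kappa sigma c | sigma <- codes (2 * n - 1) [:: true], c <- enum (colourings E)].
exists [set x in cs]; split.
  rewrite cardsE (leq_trans (card_size _)) // size_allpairs size_codes /= -cardE.
  exact: leqnn.
move=> A [a [ai [Aa aE]]] AW.
have [y0 y0P] := choice (fun t => AW (a t) ((Aa (a t)).2 (ex_intro _ t erefl))).
have y0i : injective y0 by move=> s t st; apply: ai; rewrite -!y0P st.
have [F Fi iy] := sort_points y0i; have [F' FK F'K] := ffun_bij Fi.
set y := y0 \o F in iy.
have [sigma c] := delta_seq_completes iy T_gt0.
have sc := delta_seq_code c.
have lab : col_tuple y \in colourings E.
  rewrite inE; apply/existsP; exists F; apply: labels_points iy Fi aE _ => i j.
  by rewrite -!y0P gE.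
rewrite inE; apply/allpairsP; exists (sigma, col_tuple y); split => //=.
  by rewrite mem_enum.
rewrite -(kappaP _ sc _ c) ffunE; congr chi; apply/funext => v; apply/propext.
have yE (i : 'I_#|T|) :
    e (nth [::] [seq f i | i <- delta_seq y] i) (tnth (col_tuple y) i) = a (F i).
  by rewrite (nth_map [::]) ?size_delta_seq // nth_delta_seq tnth_mktuple -y0P.
split=> [/Aa[t <-]|[i <-]]; first by exists (F' t); rewrite yE F'K.
by rewrite yE; apply/Aa; exists (F i).
Qed.

(** Each copy of the tournament is coloured by the index of its code and pattern among the [N]
    possible ones; [realize_in_copy] finds all [N] colours in every copy of S(2). *)
Theorem lower_bound L : brd_bound E L ->
  code_count (2 * #|T| - 1) 1 * #|colourings E| <= L.
Proof.
set N := (X in X <= L) => EL; have [->//|N0] := posnP N.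
pose n := #|T|.
pose Z := [seq (sigma, c) | sigma <- codes (2 * n - 1) [:: true], c <- enum (colourings E)].
have sZ : size Z = N by rewrite size_allpairs size_codes -cardE.
have uZ : uniq Z.
  by apply: allpairs_uniq; rewrite ?uniq_codes ?enum_uniq // => -[? ?] [? ?].
pose R (A : S2vert -> Prop) (z : seq move * n.-tuple bool) := exists y : 'I_n -> S2vert,
  [/\ increasing y, forall v, A v <-> exists i, y i = v,
      completes root z.1 (delta_seq y) & z.2 = col_tuple y].
have R_fun A z z' : R A z -> R A z' -> z = z'.
  move=> [y [iy Ay cy zy]] [y' [iy' Ay' cy' zy']].
  have yy : y = y' by apply: increasing_unique => // v; rewrite -Ay -Ay'.
  rewrite -yy in cy' zy'; case: z z' cy zy cy' zy' => [s c] [s' c'] /= cy -> cy' ->.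
  by congr (_, _); apply: (@completes_inj root 0) cy cy'.
have chiP A : exists i : 'I_N, forall z, z \in Z -> R A z -> index z Z = i.
  have [[z [zZ Rz]]|no] := pselect (exists z, z \in Z /\ R A z); last first.
    by exists (Ordinal N0) => z zZ Rz; case: no; exists z.
  have zN : index z Z < N by rewrite -sZ index_mem.
  by exists (Ordinal zN) => z' _ /(R_fun _ _ _ Rz) <-.
have [chi {}chiP] := choice chiP.
have [W [WS [C [CL CP]]]] := EL N N0 chi.
apply: leq_trans CL; rewrite -{1}[N]card_ord -cardsT; apply/subset_leq_card/fintype.subsetP.
move=> i _; have iZ : i < size Z by rewrite sZ.
pose z0 : seq move * n.-tuple bool := ([::], [tuple false | _ < n]).
have zZ : nth z0 Z i \in Z by apply: mem_nth.
have ind : index (nth z0 Z i) Z = i by apply: index_uniq.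
move: zZ ind; case: (nth z0 Z i) => sigma c zZ ind.
have /allpairsP[[s' c'] [/= sc cE [E1 E2]]] := zZ; rewrite -E1 -E2 mem_enum in sc cE.
have [y [iy Wy cy yc]] := realize_in_copy c WS T_gt0 sc.
pose A v := exists i, y i = v.
have -> : i = chi A.
  by apply: val_inj; rewrite /= -(chiP A _ zZ) //; exists y.
apply: CP; last by move=> _ [i' <-].
by apply: points_copy => //; rewrite yc.
Qed.

End RelatedTournament.

Theorem theorem2 (T : finType) (E : rel T) :
  (0 < #|T|)%nat -> in_class E ->
  exists N : nat,
    INR N = (2 * INR #|T| / INR #|Aut_tour E|
             * Derive_n tan (2 * #|T| - 1)%nat 0)%R /\
    brd_bound E N /\
    (forall L : nat, brd_bound E L -> (N <= L)%nat).
Proof.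
move=> T0 TC; exists (code_count (2 * #|T| - 1) 1 * #|colourings E|).
split; last by split; [exact: upper_bound|move=> L; exact: lower_bound].
have /(congr1 INR) := colourings_Aut T0 (colourings_neq0 TC).
rewrite Derive_n_tan0 !mult_INR => CA.
have A0 : INR #|Aut_tour E| <> 0%R.
  move=> A0; move: CA; rewrite A0 Rmult_0_r => /esym.
  by have := lt_0_INR #|T| (ltP T0); rewrite /=; lra.
by field_simplify_eq => //; rewrite Rmult_assoc CA /=; ring.
Qed.
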